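(* Let $E$ be a Fréchet space, let $\ell_1,\ell_2,\ell_3\in\Lambda$, and let $A,B,C$ be Köthe matrices such that the spaces $\lambda^{\ell_1}(A)$ and $\lambda^{\ell_2}(B)$ are nuclear. Suppose that $(E,\lambda^{\ell_1}(A))\in\mathcal{B}$ and $(\lambda^{\ell_2}(B),\lambda^{\ell_3}(C))\in\mathcal{B}$. Then $$\bigl(E,\ \lambda^{\ell_1}(A)\,\hat\otimes_{\pi}\,\lambda^{\ell_2}(B),\ \lambda^{\ell_3}(C)\bigr)\in\mathcal{BF}.$$
   Context: A Köthe matrix is an infinite matrix $A=(a_n^k)_{n,k\in\mathbb{N}}$ of real numbers with $0\le a_n^k\le a_n^{k+1}$ for all $n,k$ and $\sup_k a_n^k>0$ for every $n$. $\Lambda$ is the class of Banach sequence spaces $\ell$ in which the canonical unit vectors $(e_n)$ form an unconditional basis and whose norm $\|\cdot\|$ is monotone: $\|x\|\le\|y\|$ whenever $x=(x_n),y=(y_n)\in\ell$ satisfy $|x_n|\le|y_n|$ for all $n$; moreover $\|e_n\|=1$ for all $n$. For $\ell\in\Lambda$ and a Köthe matrix $A$, the $\ell$-Köthe space $\lambda^{\ell}(A)$ is the Fréchet space of all scalar sequences $x=(x_n)$ such that $(x_na_n^k)_n\in\ell$ for every $k$, with seminorms $\|x\|_k=\|(x_na_n^k)_n\|$; thus $\|e_n\|_k=a_n^k$. The topology of a Fréchet space is given by a fixed increasing fundamental sequence of seminorms $(\|\cdot\|_k)_{k\in\mathbb{N}}$. For a linear operator $T:E\to F$ between Fréchet spaces,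 $\|T\|_{p,q}=\sup\{\|Tx\|_p:\|x\|_q\le1\}\in[0,+\infty]$. $T$ is bounded if there is $N\in\mathbb{N}$ with $\|T\|_{r,N}<\infty$ for all $r\in\mathbb{N}$. One writes $(E,F)\in\mathcal{B}$ if every continuous linear operator from $E$ to $F$ is bounded. For Fréchet spaces $E,F,G$, the triple $(E,F,G)$ has the bounded factorization property, written $(E,F,G)\in\mathcal{BF}$, if each continuous linear operator $T:E\to G$ that factors over $F$ (i.e. $T=RS$ with continuous linear operators $S:E\to F$ and $R:F\to G$) is bounded. $\hat\otimes_\pi$ denotes the completed projective tensor product. *)

(* Defs.v *)
From HB Require Import structures.
From mathcomp Require Import all_boot all_order all_algebra.
From mathcomp Require Import generic_quotient ring_quotient.
From mathcomp Require Import complex.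
From mathcomp Require Import ring lra.
From mathcomp Require Import all_classical all_reals all_analysis.

Set Implicit Arguments.
Unset Strict Implicit.
Unset Printing Implicit Defensive.

Import Order.TTheory GRing.Theory Num.Theory.
Import numFieldNormedType.Exports.
Local Open Scope classical_set_scope.
Local Open Scope ring_scope.

(* The scalar field is $\mathbb{R}$ or $\mathbb{C}$; seminorms and moduli of
   scalars are real-valued in both cases. *)
Variant scalars := RealScalars | ComplexScalars.

Definition scalar (R : realType) (f : scalars) : numFieldType :=
  match f with RealScalars => R | ComplexScalars => R[i] end.

Definition modulus (R : realType) (f : scalars) : scalar R f -> R :=
  match f with
  | RealScalars => fun x : R => `|x|
  | ComplexScalars => fun z : R[i] => Normc.normc z
  end.

Definition of_real (R : realType) (f : scalars) : R -> scalar R f :=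
  match f with
  | RealScalars => fun x : R => x
  | ComplexScalars => fun x : R => (x%:C)%C
  end.
Arguments of_real {R} f x.

Section scalar_theory.
Variables (R : realType) (f : scalars).
Implicit Types a b : scalar R f.

Lemma modulus_ge0 a : 0 <= modulus a.
Proof.
by case: f a => [x|[x y]] /=; [exact: normr_ge0|exact: sqrtr_ge0].
Qed.

Lemma modulusM a b : modulus (a * b) = modulus a * modulus b.
Proof.
case: f a b => /= x y; first exact: normrM.
exact: Normc.normcM.
Qed.

Lemma modulusD a b : modulus (a + b) <= modulus a + modulus b.
Proof.
case: f a b => /= x y; first exact: ler_normD.
exact: (@le_normcD R x y).
Qed.

Lemma modulus1 : modulus (1 : scalar R f) = 1.
Proof. by case: f => /=; [exact: normr1|exact: Normc.normc1]. Qed.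

Lemma modulusN a : modulus (- a) = modulus a.
Proof.
case: f a => /= x; first exact: normrN.
exact: (@normcN R x).
Qed.

Lemma modulus0 : modulus (0 : scalar R f) = 0.
Proof. by case: f => /=; [exact: normr0|exact: Normc.normc0]. Qed.

Lemma modulus_eq0 a : modulus a = 0 -> a = 0.
Proof.
case: f a => /= x; first by move=> /eqP; rewrite normr_eq0 => /eqP.
exact: Normc.eq0_normc.
Qed.

Lemma modulus_of_real (x : R) : modulus (of_real f x) = `|x|.
Proof.
by case: f => //=; rewrite /= expr0n /= addr0 sqrtr_sqr.
Qed.

End scalar_theory.

Section linear_subspace.
Variables (K : pzRingType) (V : lmodType K) (W : submodClosed V).

Record linear_subspace := LinearSubspace { inclusion : V; _ : inclusion \in W }.

HB.instance Definition _ := [isSub for inclusion].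
HB.instance Definition _ := [Choice of linear_subspace by <:].
HB.instance Definition _ := [SubChoice_isSubLmodule of linear_subspace by <:].

Lemma linear_subspaceP (x : linear_subspace) : inclusion x \in W.
Proof. by case: x. Qed.

End linear_subspace.

Section linear_quotient.
Variables (K : pzRingType) (V : lmodType K) (W : submodClosed V).
Local Open Scope quotient_scope.

Definition quotient_null : {pred V} := fun x => x \in W.

Fact quotient_null_closed : zmod_closed quotient_null.
Proof. exact/GRing.subsemimod_closedB/GRing.subsemimodClosedP. Qed.

HB.instance Definition _ :=
  GRing.isZmodClosed.Build V quotient_null quotient_null_closed.

Definition linear_quotient := Quotient.quot quotient_null.

HB.instance Definition _ := GRing.Zmodule.on linear_quotient.
HB.instance Definition _ := EqQuotient.on linear_quotient.

Definition quotient_class (x : V) : linear_quotient := \pi_linear_quotient x.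

Lemma quotient_classE x y : quotient_class x = quotient_class y <-> x - y \in W.
Proof.
split=> [/eqP|h]; first by rewrite -Quotient.idealrBE.
by apply/eqP; rewrite -Quotient.idealrBE.
Qed.

Lemma quotient_classD x y :
  quotient_class (x + y) = quotient_class x + quotient_class y.
Proof. by rewrite /quotient_class [LHS]raddfD. Qed.

Lemma quotient_reprK (q : linear_quotient) : quotient_class (repr q) = q.
Proof. exact: reprK. Qed.

Definition quotient_scale (a : K) (q : linear_quotient) : linear_quotient :=
  quotient_class (a *: repr q).

Lemma quotient_classZ a x :
  quotient_class (a *: x) = quotient_scale a (quotient_class x).
Proof.
apply/quotient_classE; rewrite -scalerBr; apply: rpredZ.
by apply/quotient_classE; rewrite quotient_reprK.
Qed.

Fact quotient_scaleA a b q :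
  quotient_scale a (quotient_scale b q) = quotient_scale (a * b) q.
Proof.
by rewrite -[q]quotient_reprK -!quotient_classZ scalerA.
Qed.

Fact quotient_scale1 : left_id 1 quotient_scale.
Proof.
by move=> q; rewrite -[q]quotient_reprK -!quotient_classZ scale1r.
Qed.

Fact quotient_scaleDr : right_distributive quotient_scale +%R.
Proof.
move=> a p q; rewrite -[p]quotient_reprK -[q]quotient_reprK.
by rewrite -quotient_classD -!quotient_classZ scalerDr quotient_classD.
Qed.

Fact quotient_scaleDl q : {morph quotient_scale^~ q : a b / a + b}.
Proof.
move=> a b; rewrite -[q]quotient_reprK -!quotient_classZ scalerDl.
exact: quotient_classD.
Qed.

HB.instance Definition _ := GRing.Zmodule_isLmodule.Build K linear_quotient
  quotient_scaleA quotient_scale1 quotient_scaleDr quotient_scaleDl.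

Fact quotient_class_linear : linear quotient_class.
Proof. by move=> a x y; rewrite quotient_classD quotient_classZ. Qed.

HB.instance Definition _ :=
  GRing.isLinear.Build K V linear_quotient _ quotient_class
    quotient_class_linear.

End linear_quotient.

(* A locally convex space whose topology is given by an increasing sequence of
   seminorms; neither separation nor completeness is required. *)
Record gradedSpace (R : realType) (f : scalars) := GradedSpace {
  graded_carrier : lmodType (scalar R f);
  graded_seminorm : nat -> graded_carrier -> R;
  graded_seminormD : forall k x y,
    graded_seminorm k (x + y) <= graded_seminorm k x + graded_seminorm k y;
  graded_seminormZ : forall k a x,
    graded_seminorm k (a *: x) = modulus a * graded_seminorm k x;
  graded_seminorm_incr : forall k x,
    graded_seminorm k x <= graded_seminorm k.+1 x
}.

Definition graded_space (R : realType) (f : scalars) (E : gradedSpace R f) :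
  Type := graded_carrier E.
Coercion graded_space : gradedSpace >-> Sortclass.

HB.instance Definition _ (R : realType) (f : scalars) (E : gradedSpace R f) :=
  GRing.Lmodule.copy (graded_space E) (graded_carrier E).

Definition seminorm (R : realType) (f : scalars) (E : gradedSpace R f)
  (k : nat) (x : E) : R := @graded_seminorm R f E k x.

Section graded_topology.
Variables (R : realType) (f : scalars) (E : gradedSpace R f).
Implicit Types (x y : E) (k : nat).

Lemma seminormD k x y : seminorm k (x + y) <= seminorm k x + seminorm k y.
Proof. exact: graded_seminormD. Qed.

Lemma seminormZ k a x : seminorm k (a *: x) = modulus a * seminorm k x.
Proof. exact: graded_seminormZ. Qed.

Lemma seminorm_incr k m x : (k <= m)%N -> seminorm k x <= seminorm m x.
Proof.
move=> /subnK <-; elim: (m - k)%N => [|d IH]; first by rewrite add0n.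
by apply: (le_trans IH); rewrite addSn; exact: graded_seminorm_incr.
Qed.

Lemma seminorm0 k : seminorm k (0 : E) = 0.
Proof. by rewrite -(scale0r 0) seminormZ modulus0 mul0r. Qed.

Lemma seminormN k x : seminorm k (- x) = seminorm k x.
Proof. by rewrite -scaleN1r seminormZ modulusN modulus1 mul1r. Qed.

Lemma seminormB k x y : seminorm k (x - y) = seminorm k (y - x).
Proof. by rewrite -seminormN opprB. Qed.

Lemma seminorm_ge0 k x : 0 <= seminorm k x.
Proof.
have := seminormD k x (- x).
by rewrite subrr seminorm0 seminormN -mulr2n pmulrn_lge0.
Qed.

Lemma seminorm_tri k x y z :
  seminorm k (x - z) <= seminorm k (x - y) + seminorm k (y - z).
Proof. by rewrite -[x - z](subrKA y); exact: seminormD. Qed.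

Definition graded_entourage : set_system (E * E) :=
  [set A | exists k, exists2 e : R, 0 < e &
     forall x y, seminorm k (x - y) < e -> A (x, y)].

Fact graded_entourage_filter : Filter graded_entourage.
Proof.
split=> [|A B [k [e e0 Ae]] [m [d d0 Bd]]|A B AB [k [e e0 Ae]]].
- by exists 0%N, 1.
- exists (maxn k m), (Num.min e d) => [|x y]; first by rewrite lt_min e0.
  rewrite lt_min => /andP[xe xd]; split.
  + by apply/Ae/le_lt_trans/xe/seminorm_incr/leq_maxl.
  + by apply/Bd/le_lt_trans/xd/seminorm_incr/leq_maxr.
- by exists k, e => // x y /Ae /AB.
Qed.

Local Open Scope relation_scope.

Fact graded_entourage_diagonal A : graded_entourage A -> diagonal `<=` A.
Proof.
move=> [k [e e0 Ae]] [x y] xy; have <- : x = y by exact: xy.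
by apply: Ae; rewrite subrr seminorm0.
Qed.

Fact graded_entourage_inv A : graded_entourage A -> graded_entourage A^-1.
Proof.
move=> [k [e e0 Ae]]; exists k, e => // x y xy.
by apply: Ae; rewrite seminormB.
Qed.

Fact graded_entourage_split A :
  graded_entourage A -> exists2 B, graded_entourage B & B \; B `<=` A.
Proof.
move=> [k [e e0 Ae]].
exists [set xy | seminorm k (xy.1 - xy.2) < e / 2].
  by exists k, (e / 2) => //; exact: divr_gt0.
move=> [x z] [y /= xy yz]; apply/Ae/(le_lt_trans (seminorm_tri k x y z)).
by rewrite [e]splitr ltrD.
Qed.

Local Close Scope relation_scope.

HB.instance Definition _ := isUniform.Build (graded_space E)
  graded_entourage_filter graded_entourage_diagonal graded_entourage_inv
  graded_entourage_split.

HB.instance Definition _ := isPointed.Build (graded_space E) 0.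

Lemma graded_nbhsP x (A : set E) : nbhs x A <->
  exists k, exists2 e : R, 0 < e & forall y, seminorm k (x - y) < e -> A y.
Proof.
split.
  move=> [B [k [e e0 Be]] BA]; exists k, e => // y xy.
  by apply: BA; apply/xsectionP/Be.
move=> [k [e e0 Ae]]; exists [set xy | seminorm k (xy.1 - xy.2) < e].
  by exists k, e.
by move=> y /xsectionP /= /Ae.
Qed.

Lemma graded_cvgP (u : nat -> E) x : u @ \oo --> x <->
  forall k (e : R), 0 < e -> exists N, forall n, (N <= n)%N ->
    seminorm k (x - u n) < e.
Proof.
split=> [ux k e e0|ux A /graded_nbhsP [k [e e0 Ae]]].
  have /ux [N _ uN] : nbhs x [set y | seminorm k (x - y) < e].
    by apply/graded_nbhsP; exists k, e.
  by exists N.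
by have [N uN] := ux k e e0; exists N => // n /uN /Ae.
Qed.

Lemma graded_cauchyP (u : nat -> E) : cauchy (u @ \oo) <->
  forall k (e : R), 0 < e -> exists N, forall m n, (N <= m)%N -> (N <= n)%N ->
    seminorm k (u m - u n) < e.
Proof.
split=> [uc k e e0|uc A [k [e e0 Ae]]].
  have /uc : entourage [set xy : E * E | seminorm k (xy.1 - xy.2) < e].
    by exists k, e.
  move=> [[B C] [[M _ BM] [N _ CN]] BC]; exists (maxn M N) => m n Mm Nn.
  apply: (BC (u m, u n)); split.
    by apply: BM => /=; exact: leq_trans (leq_maxl _ _) Mm.
  by apply: CN => /=; exact: leq_trans (leq_maxr _ _) Nn.
have [N uN] := uc k e e0.
exists (u @` [set n | (N <= n)%N], u @` [set n | (N <= n)%N]).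
  by split; exists N => // n Nn; exists n.
by move=> [x y] [[/= m Nm <-] [/= n Nn <-]]; apply/Ae/uN.
Qed.

Lemma graded_hausdorffP : (forall x, (forall k, seminorm k x = 0) -> x = 0) ->
  hausdorff_space E.
Proof.
move=> sep x y xy; apply/eqP; rewrite -subr_eq0; apply/eqP/sep => k.
apply/eqP; rewrite eq_le seminorm_ge0 andbT; apply/ler_addgt0Pr => e e0.
rewrite add0r.
pose V (z : E) := [set w | seminorm k (z - w) < e / 2].
have nV z : nbhs z (V z).
  by apply/graded_nbhsP; exists k, (e / 2) => //; exact: divr_gt0.
have [z [/= xz yz]] := xy _ _ (nV x) (nV y).
apply: (le_trans (seminorm_tri k x z y)).
by rewrite [e]splitr (seminormB k z) lerD // ltW.
Qed.

Lemma hausdorff_seminorm_eq0 : hausdorff_space E ->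
  forall x, (forall k, seminorm k x = 0) -> x = 0.
Proof.
move=> hE x x0; apply: hE => A B /graded_nbhsP[k [e e0 Ae]] Bn.
exists 0; split; last exact: nbhs_singleton.
by apply: Ae; rewrite subr0 x0.
Qed.

End graded_topology.

(* The topology is metrizable, so sequential completeness is completeness. *)
Record frechetSpace (R : realType) (f : scalars) := FrechetSpace {
  frechet_graded :> gradedSpace R f;
  frechet_hausdorff : hausdorff_space frechet_graded;
  frechet_complete : forall u : nat -> frechet_graded,
    cauchy (u @ \oo) -> cvg (u @ \oo)
}.

Section bounded_operators.
Variables (R : realType) (f : scalars).
Implicit Types E F G : gradedSpace R f.

(* $\|T\|_{p,q}$ *)
Definition operator_seminorm E F (T : E -> F) (p q : nat) : \bar R :=
  ereal_sup [set (seminorm p (T x))%:E | x in [set x | seminorm q x <= 1]].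

Definition bounded_operator E F (T : E -> F) : Prop :=
  exists N, forall r, (operator_seminorm T r N < +oo)%E.

(* $(E,F)\in\mathcal{B}$ *)
Definition all_bounded E F : Prop :=
  forall T : {linear E -> F}, continuous T -> bounded_operator T.

(* $(E,F,G)\in\mathcal{BF}$ *)
Definition bounded_factorization E F G : Prop :=
  forall T : {linear E -> G}, continuous T ->
    (exists (S : {linear E -> F}) (Q : {linear F -> G}),
      [/\ continuous S, continuous Q & T =1 Q \o S]) ->
    bounded_operator T.

End bounded_operators.

(* Hausdorff completion: Cauchy sequences modulo null sequences, the $k$-th
   seminorm of the class of $u$ being $\lim_n \|u_n\|_k$. *)
Section completion.
Variables (R : realType) (f : scalars) (G : gradedSpace R f).

Definition is_cauchy : {pred nat -> G} := fun u => `[< cauchy (u @ \oo) >].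

Lemma is_cauchyP (u : nat -> G) : reflect
  (forall k (e : R), 0 < e -> exists N, forall m n, (N <= m)%N -> (N <= n)%N ->
    seminorm k (u m - u n) < e) (u \in is_cauchy).
Proof. by apply: (iffP (asboolP _)) => /graded_cauchyP. Qed.

Fact is_cauchy_closed : subsemimod_closed is_cauchy.
Proof.
split; first split.
- by apply/is_cauchyP => k e e0; exists 0%N => m n _ _; rewrite subrr seminorm0.
- move=> u v /is_cauchyP uc /is_cauchyP vc; apply/is_cauchyP => k e e0.
  have e20 : 0 < e / 2 by exact: divr_gt0.
  have [M uM] := uc k _ e20; have [N vN] := vc k _ e20.
  exists (maxn M N) => m n; rewrite !geq_max => /andP[Mm Nm] /andP[Mn Nn].
  rewrite -[(u + v) m]/(u m + v m) -[(u + v) n]/(u n + v n) opprD addrACA.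
  apply: (le_lt_trans (seminormD k _ _)).
  by rewrite [e]splitr ltrD // ?uM ?vN.
- move=> a u /is_cauchyP uc; apply/is_cauchyP => k e e0.
  have a0 : 0 < modulus a + 1 by rewrite ltr_pwDr // modulus_ge0.
  have [N uN] := uc k (e / (modulus a + 1)) (divr_gt0 e0 a0).
  exists N => m n Nm Nn.
  rewrite -[(a *: u) m]/(a *: u m) -[(a *: u) n]/(a *: u n) -scalerBr seminormZ.
  apply: (@le_lt_trans _ _ ((modulus a + 1) * seminorm k (u m - u n))).
    by rewrite ler_wpM2r ?seminorm_ge0 // lerDl.
  by rewrite mulrC -ltr_pdivlMr // uN.
Qed.

HB.instance Definition _ :=
  GRing.isSubmodClosed.Build (scalar R f) (nat -> G) is_cauchy is_cauchy_closed.

Definition is_null : {pred linear_subspace is_cauchy} :=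
  fun u => `[< inclusion u @ \oo --> (0 : G) >].

Lemma is_nullP (u : linear_subspace is_cauchy) : reflect
  (forall k (e : R), 0 < e -> exists N, forall n, (N <= n)%N ->
    seminorm k (inclusion u n) < e) (u \in is_null).
Proof.
apply: (iffP (asboolP _)) => [/graded_cvgP uc k e /uc-/(_ k)[N uN]|uc].
  by exists N => n /uN; rewrite sub0r seminormN.
apply/graded_cvgP => k e /uc-/(_ k)[N uN].
by exists N => n /uN; rewrite sub0r seminormN.
Qed.

Fact is_null_closed : subsemimod_closed is_null.
Proof.
split; first split.
- apply/is_nullP => k e e0; exists 0%N => n _.
  by rewrite (_ : inclusion 0 n = 0) ?seminorm0.
- move=> u v /is_nullP uc /is_nullP vc; apply/is_nullP => k e e0.
  have e20 : 0 < e / 2 by exact: divr_gt0.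
  have [M uM] := uc k _ e20; have [N vN] := vc k _ e20.
  exists (maxn M N) => n; rewrite !geq_max => /andP[Mn Nn].
  apply: (le_lt_trans (seminormD k (inclusion u n) (inclusion v n))).
  by rewrite [e]splitr ltrD // ?uM ?vN.
- move=> a u /is_nullP uc; apply/is_nullP => k e e0.
  have a0 : 0 < modulus a + 1 by rewrite ltr_pwDr // modulus_ge0.
  have [N uN] := uc k (e / (modulus a + 1)) (divr_gt0 e0 a0).
  exists N => n Nn.
  rewrite -[inclusion (a *: u) n]/(a *: inclusion u n) seminormZ.
  apply: (@le_lt_trans _ _ ((modulus a + 1) * seminorm k (inclusion u n))).
    by rewrite ler_wpM2r ?seminorm_ge0 // lerDl.
  by rewrite mulrC -ltr_pdivlMr // uN.
Qed.

HB.instance Definition _ :=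
  GRing.isSubmodClosed.Build (scalar R f) (linear_subspace is_cauchy) is_null
    is_null_closed.

Definition completion_carrier : lmodType (scalar R f) :=
  linear_quotient is_null.

Definition cauchy_class (u : linear_subspace is_cauchy) : completion_carrier :=
  quotient_class is_null u.

Definition completion_seminorm (k : nat) (q : completion_carrier) : R :=
  limn (fun n => seminorm k (inclusion (repr q) n)).

Lemma seminorm_dist k (x y : G) :
  `|seminorm k x - seminorm k y| <= seminorm k (x - y).
Proof.
rewrite ler_norml; apply/andP; split.
  rewrite lerNl opprB lerBlDr seminormB.
  by rewrite -[X in seminorm k X <= _](subrK x y); exact: seminormD.
by rewrite lerBlDr -[X in seminorm k X <= _](subrK y x); exact: seminormD.
Qed.

Lemma is_cvg_seminorm k (u : linear_subspace is_cauchy) :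
  cvgn (fun n => seminorm k (inclusion u n)).
Proof.
apply/cauchy_cvgP/cauchy_exP => e e0.
have /is_cauchyP uc := linear_subspaceP u.
have [N uN] := uc k e e0.
exists (seminorm k (inclusion u N)); exists N => // n /= Nn.
by apply: (le_lt_trans (seminorm_dist _ _ _)); exact: uN.
Qed.

Lemma completion_seminorm_class k u :
  (fun n => seminorm k (inclusion u n)) @ \oo -->
    completion_seminorm k (cauchy_class u).
Proof.
rewrite /completion_seminorm; set v := repr _.
have /is_nullP uv : u - v \in is_null.
  by apply/quotient_classE; rewrite quotient_reprK.
have vc := @is_cvg_seminorm k v.
apply/cvgrPdist_lt => e e0; have e20 : 0 < e / 2 by exact: divr_gt0.
have [M uvM] := uv k _ e20.
move/cvgrPdist_lt: vc => /(_ _ e20)[N _ vN].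
exists (maxn M N) => // n /=; rewrite geq_max => /andP[Mn Nn].
rewrite -[_ - _](subrKA (seminorm k (inclusion v n))).
apply: (le_lt_trans (ler_normD _ _)); rewrite [e]splitr ltrD //.
  exact: vN.
rewrite distrC; apply: (le_lt_trans (seminorm_dist _ _ _)); exact: uvM.
Qed.

Lemma cauchy_classP (q : completion_carrier) : exists u, q = cauchy_class u.
Proof. by exists (repr q); rewrite /cauchy_class quotient_reprK. Qed.

Lemma cauchy_classD u v :
  cauchy_class u + cauchy_class v = cauchy_class (u + v).
Proof. by rewrite /cauchy_class quotient_classD. Qed.

Lemma cauchy_classZ a u : a *: cauchy_class u = cauchy_class (a *: u).
Proof. by rewrite /cauchy_class quotient_classZ. Qed.

Fact completion_seminormD k p q : completion_seminorm k (p + q) <=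
  completion_seminorm k p + completion_seminorm k q.
Proof.
have [[u ->] [v ->]] := (cauchy_classP p, cauchy_classP q).
rewrite cauchy_classD.
have uc := @completion_seminorm_class k u.
have vc := @completion_seminorm_class k v.
have uvc := @completion_seminorm_class k (u + v).
apply: (ler_cvg_to uvc (cvgD uc vc)).
by apply: nearW => n; exact: seminormD.
Qed.

Fact completion_seminormZ k a q :
  completion_seminorm k (a *: q) = modulus a * completion_seminorm k q.
Proof.
have [u ->] := cauchy_classP q.
rewrite cauchy_classZ.
have uc := @completion_seminorm_class k u.
have auc := @completion_seminorm_class k (a *: u).
have aucM : (fun n => seminorm k (inclusion (a *: u) n)) @ \oo -->
    modulus a * completion_seminorm k (cauchy_class u).
  under eq_fun do rewrite -[inclusion _ _]/(a *: inclusion u _) seminormZ.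
  exact: (cvgM (cvg_cst _) uc).
exact: norm_cvg_unique auc aucM.
Qed.

Fact completion_seminorm_incr k q :
  completion_seminorm k q <= completion_seminorm k.+1 q.
Proof.
have [u ->] := cauchy_classP q.
apply: (ler_cvg_to (@completion_seminorm_class k u)
  (@completion_seminorm_class k.+1 u)).
by apply: nearW => n; exact: seminorm_incr.
Qed.

Definition completion_graded : gradedSpace R f :=
  @GradedSpace R f completion_carrier completion_seminorm
    completion_seminormD completion_seminormZ completion_seminorm_incr.

Fact const_is_cauchy (x : G) : (fun _ : nat => x) \in is_cauchy.
Proof.
by apply/is_cauchyP => k e e0; exists 0%N => m n _ _; rewrite subrr seminorm0.
Qed.

Definition embedding (x : G) : completion_graded :=
  cauchy_class (LinearSubspace (const_is_cauchy x)).

Fact embedding_linear : linear embedding.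
Proof.
move=> a x y; transitivity (cauchy_class
    (a *: LinearSubspace (const_is_cauchy x) +
     LinearSubspace (const_is_cauchy y))).
  by congr cauchy_class; exact: val_inj.
by rewrite -cauchy_classD -cauchy_classZ.
Qed.

HB.instance Definition _ := GRing.isLinear.Build (scalar R f) G
  completion_graded _ embedding embedding_linear.

Lemma seminorm_embedding k x : seminorm k (embedding x) = seminorm k x.
Proof.
have xc := @completion_seminorm_class k (LinearSubspace (const_is_cauchy x)).
have kc : (fun _ : nat => seminorm k x) @ \oo --> seminorm k x.
  exact: cvg_cst.
exact: norm_cvg_unique xc kc.
Qed.

Lemma cauchy_class_cvg u k (e : R) : 0 < e -> exists N, forall n, (N <= n)%N ->
  seminorm k ((cauchy_class u : completion_graded) - embedding (inclusion u n))
    < e.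
Proof.
move=> e0; have /is_cauchyP uc := linear_subspaceP u.
have e20 : 0 < e / 2 by exact: divr_gt0.
have [N uN] := uc k _ e20; exists N => n Nn.
apply: (@le_lt_trans _ _ (e / 2)); last first.
  by rewrite ltr_pdivrMr // ltr_pMr // ltr1n.
rewrite (_ : _ - _ =
  cauchy_class (u - LinearSubspace (const_is_cauchy (inclusion u n))));
    last first.
  by rewrite /embedding /cauchy_class !raddfB.
set w := u - _; have wc := @completion_seminorm_class k w.
have ec : (fun _ : nat => e / 2) @ \oo --> e / 2 by exact: cvg_cst.
apply: (ler_cvg_to wc ec).
by exists N => // m /= Nm; rewrite ltW // uN.
Qed.

Lemma embedding_dense (q : completion_graded) k (e : R) : 0 < e ->
  exists x, seminorm k (q - embedding x) < e.
Proof.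
move=> e0; have [u ->] := cauchy_classP q.
have [N uN] := @cauchy_class_cvg u k e e0.
by exists (inclusion u N); exact: uN.
Qed.

Fact completion_hausdorff : hausdorff_space completion_graded.
Proof.
apply: graded_hausdorffP => q q0; have [u qu] := cauchy_classP q.
rewrite qu -[0](raddf0 (quotient_class is_null)); apply/quotient_classE.
rewrite subr0; apply/is_nullP => k e e0.
have /cvgrPdist_lt/(_ _ e0)[N _ uN] := @completion_seminorm_class k u.
exists N => n /uN; rewrite -qu -[completion_seminorm k q]/(seminorm k q) q0.
by rewrite sub0r normrN ger0_norm // seminorm_ge0.
Qed.

Fact completion_complete (q : nat -> completion_graded) :
  cauchy (q @ \oo) -> cvg (q @ \oo).
Proof.
move=> /graded_cauchyP qc.
have /choice[x xq] n : exists y, seminorm n (q n - embedding y) < n.+1%:R^-1.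
  by apply: embedding_dense; rewrite invr_gt0.
have xqk k (e : R) : 0 < e -> exists N, forall n, (N <= n)%N ->
    seminorm k (q n - embedding (x n)) < e.
  move=> e0; exists (maxn k (Num.truncn e^-1)) => n.
  rewrite geq_max => /andP[kn en].
  apply/(le_lt_trans (seminorm_incr _ kn))/(lt_le_trans (xq n)).
  rewrite invf_ple ?posrE //; apply: ltW.
  apply: (lt_le_trans (truncnS_gt _)); by rewrite ler_nat.
have xc : x \in is_cauchy.
  apply/is_cauchyP => k e e0; have e30 : 0 < e / 3 by exact: divr_gt0.
  have [M qM] := qc k _ e30; have [N xN] := xqk k _ e30.
  exists (maxn M N) => m n; rewrite !geq_max => /andP[Mm Nm] /andP[Mn Nn].
  rewrite -seminorm_embedding raddfB /=.
  apply: (le_lt_trans (seminorm_tri k _ (q m) _)).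
  have -> : e = e / 3 + (e / 3 + e / 3) by lra.
  rewrite ltrD // ?[seminorm k (_ - q m)]seminormB ?xN //.
  apply: (le_lt_trans (seminorm_tri k _ (q n) _)).
  by rewrite ltrD ?xN ?qM.
pose z : completion_graded := cauchy_class (LinearSubspace xc).
apply/cvg_ex; exists z; apply/graded_cvgP => k e e0.
have e20 : 0 < e / 2 by exact: divr_gt0.
have [M xM] := @cauchy_class_cvg (LinearSubspace xc) k _ e20.
have [N xN] := xqk k _ e20.
exists (maxn M N) => n; rewrite geq_max => /andP[Mn Nn].
apply: (le_lt_trans (seminorm_tri k _ (embedding (x n)) _)).
rewrite [e]splitr ltrD //; first exact: xM.
by rewrite seminormB xN.
Qed.

Definition completion : frechetSpace R f :=
  FrechetSpace completion_hausdorff completion_complete.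

End completion.

(* $E\otimes F$ is realized as the space of functionals on the (not necessarily
   continuous) bilinear forms spanned by the evaluations
   $x\otimes y : b\mapsto b(x,y)$. Bilinear forms separate the points of the
   algebraic tensor product, so equality of such functionals is equality
   in $E\otimes F$. *)
Section projective_tensor_product.
Variables (R : realType) (f : scalars) (E F : gradedSpace R f).
Local Notation K := (scalar R f).

Definition bilinear_form := {bilinear E -> F -> K^o}.

Definition elementary_tensor (x : E) (y : F) : bilinear_form -> K^o :=
  fun b => b x y.

Definition tensor_sum (s : seq (E * F)) : bilinear_form -> K^o :=
  \sum_(z <- s) elementary_tensor z.1 z.2.

Definition is_tensor : {pred bilinear_form -> K^o} :=
  fun u => `[< exists s, u = tensor_sum s >].

Lemma tensor_sumD s t : tensor_sum (s ++ t) = tensor_sum s + tensor_sum t.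
Proof. exact: big_cat. Qed.

Lemma tensor_sumZ a s :
  tensor_sum [seq (a *: z.1, z.2) | z <- s] = a *: tensor_sum s.
Proof.
rewrite /tensor_sum big_map scaler_sumr; apply: eq_bigr => z _ /=.
by apply/funext => b; rewrite /elementary_tensor linearZl_LR.
Qed.

Fact is_tensor_closed : subsemimod_closed is_tensor.
Proof.
split; first split.
- by apply/asboolP; exists [::]; rewrite /tensor_sum big_nil.
- move=> _ _ /asboolP[s ->] /asboolP[t ->]; apply/asboolP.
  by exists (s ++ t); rewrite tensor_sumD.
- move=> a _ /asboolP[s ->]; apply/asboolP.
  by exists [seq (a *: z.1, z.2) | z <- s]; rewrite tensor_sumZ.
Qed.

HB.instance Definition _ :=
  GRing.isSubmodClosed.Build K (bilinear_form -> K^o) is_tensor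
    is_tensor_closed.

Definition tensor_carrier : lmodType K := linear_subspace is_tensor.

Implicit Types (u v : tensor_carrier) (s t : seq (E * F)) (k : nat).

Definition representation_cost k s : R :=
  \sum_(z <- s) seminorm k z.1 * seminorm k z.2.

Definition representation_costs k u : set R :=
  [set representation_cost k s | s in [set s | inclusion u = tensor_sum s]].

(* $\pi_k(u)=\inf\{\sum_i\|x_i\|_k\|y_i\|_k : u=\sum_i x_i\otimes y_i\}$; as
   both gradings increase, these generate the projective topology. *)
Definition projective_seminorm k u : R := inf (representation_costs k u).

Lemma representation_cost_ge0 k s : 0 <= representation_cost k s.
Proof. by apply: sumr_ge0 => z _; rewrite mulr_ge0 ?seminorm_ge0. Qed.

Lemma projective_seminorm_le k u s :
  inclusion u = tensor_sum s ->
  projective_seminorm k u <= representation_cost k s.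
Proof.
move=> us; apply: ge_inf; last by exists s.
by exists 0 => _ [t _ <-]; exact: representation_cost_ge0.
Qed.

Lemma has_inf_representation_costs k u : has_inf (representation_costs k u).
Proof.
split; last by exists 0 => _ [t _ <-]; exact: representation_cost_ge0.
have /asboolP[s us] := linear_subspaceP u.
by exists (representation_cost k s), s.
Qed.

Lemma projective_seminorm_adherent k u (e : R) : 0 < e ->
  exists2 s, inclusion u = tensor_sum s &
    representation_cost k s < projective_seminorm k u + e.
Proof.
move=> e0.
have [_ [s us <-] se] := inf_adherent e0 (has_inf_representation_costs k u).
by exists s.
Qed.

Lemma projective_seminorm_ge0 k u : 0 <= projective_seminorm k u.
Proof.
apply: lb_le_inf; first by have [] := has_inf_representation_costs k u.
by move=> _ [s _ <-]; exact: representation_cost_ge0.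
Qed.

Fact projective_seminormD k u v : projective_seminorm k (u + v) <=
  projective_seminorm k u + projective_seminorm k v.
Proof.
apply/ler_addgt0Pr => e e0; have e20 : 0 < e / 2 by exact: divr_gt0.
have [s us se] := projective_seminorm_adherent k u e20.
have [t vt te] := projective_seminorm_adherent k v e20.
have uvst : inclusion (u + v) = tensor_sum (s ++ t).
  by rewrite tensor_sumD -us -vt.
apply: (le_trans (projective_seminorm_le k uvst)).
rewrite /representation_cost big_cat /= -!/(representation_cost _ _).
by rewrite [e]splitr addrACA lerD // ltW.
Qed.

Lemma projective_seminormZ_le k a u :
  projective_seminorm k (a *: u) <= modulus a * projective_seminorm k u.
Proof.
apply/ler_addgt0Pr => e e0.
have a0 : 0 < modulus a + 1 by rewrite ltr_pwDr // modulus_ge0.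
have [s us se] := projective_seminorm_adherent k u (divr_gt0 e0 a0).
have aus : inclusion (a *: u) = tensor_sum [seq (a *: z.1, z.2) | z <- s].
  by rewrite tensor_sumZ -us.
apply: (le_trans (projective_seminorm_le k aus)).
rewrite /representation_cost big_map /=.
under eq_bigr do rewrite seminormZ -mulrA.
rewrite -mulr_sumr -/(representation_cost k s).
apply: (le_trans (ler_wpM2l (modulus_ge0 a) (ltW se))).
rewrite mulrDr lerD2l mulrCA ler_piMr ?(ltW e0) //.
by rewrite ler_pdivrMr // mul1r lerDl.
Qed.

Fact projective_seminormZ k a u :
  projective_seminorm k (a *: u) = modulus a * projective_seminorm k u.
Proof.
apply/eqP; rewrite eq_le projective_seminormZ_le /=.
have [->|a0] := eqVneq a 0.
  by rewrite modulus0 mul0r projective_seminorm_ge0.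
have am0 : 0 < modulus a.
  rewrite lt_neqAle modulus_ge0 andbT eq_sym; apply: contra a0.
  by move=> /eqP/modulus_eq0/eqP.
rewrite -ler_pdivlMl //.
apply: (@le_trans _ _ (projective_seminorm k (a^-1 *: (a *: u)))).
  by rewrite scalerA mulVf // scale1r.
apply: (le_trans (projective_seminormZ_le _ _ _)); rewrite ler_wpM2r //.
  exact: projective_seminorm_ge0.
rewrite -[leRHS]mul1r ler_pdivlMr //.
by rewrite -modulusM mulVf // modulus1.
Qed.

Fact projective_seminorm_incr k u :
  projective_seminorm k u <= projective_seminorm k.+1 u.
Proof.
apply: lb_le_inf; first by have [] := has_inf_representation_costs k.+1 u.
move=> _ [s us <-]; apply: (le_trans (projective_seminorm_le k us)).
by apply: ler_sum => z _; rewrite ler_pM ?seminorm_ge0 ?seminorm_incr.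
Qed.

Definition algebraic_tensor : gradedSpace R f :=
  @GradedSpace R f tensor_carrier projective_seminorm
    projective_seminormD projective_seminormZ projective_seminorm_incr.

Definition projective_tensor : frechetSpace R f := completion algebraic_tensor.

Fact elementary_is_tensor x y : elementary_tensor x y \in is_tensor.
Proof.
by apply/asboolP; exists [:: (x, y)]; rewrite /tensor_sum big_seq1.
Qed.

Definition tensor (x : E) (y : F) : projective_tensor :=
  @embedding R f algebraic_tensor (LinearSubspace (elementary_is_tensor x y)).

End projective_tensor_product.

Record kotheMatrix (R : realType) := KotheMatrix {
  kothe_entry :> nat -> nat -> R;
  kothe_entry_ge0 : forall n k, 0 <= kothe_entry n k;
  kothe_entry_incr : forall n k, kothe_entry n k <= kothe_entry n k.+1;
  kothe_entry_sup : forall n,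
    (0 < ereal_sup (range (fun k => (kothe_entry n k)%:E)))%E
}.

Section sequence_spaces.
Variables (R : realType) (f : scalars).
Local Notation K := (scalar R f).

Definition unit_sequence (n : nat) : nat -> K^o := fun j => (j == n)%:R.

(* [seq_norm] is meaningful only on the members of the space. *)
Record banachSequenceSpace := BanachSequenceSpace {
  seq_mem :> (nat -> K^o) -> Prop;
  seq_norm : (nat -> K^o) -> R;
  seq_mem0 : seq_mem 0;
  seq_memD : forall x y, seq_mem x -> seq_mem y -> seq_mem (x + y);
  seq_memZ : forall a x, seq_mem x -> seq_mem (a *: x);
  seq_normD : forall x y, seq_mem x -> seq_mem y ->
    seq_norm (x + y) <= seq_norm x + seq_norm y;
  seq_normZ : forall a x, seq_mem x ->
    seq_norm (a *: x) = modulus a * seq_norm x;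
  seq_norm_eq0 : forall x, seq_mem x -> seq_norm x = 0 -> x = 0;
  seq_complete : forall u : nat -> nat -> K^o, (forall i, seq_mem (u i)) ->
    (forall e : R, 0 < e -> exists N, forall i j, (N <= i)%N -> (N <= j)%N ->
       seq_norm (u i - u j) < e) ->
    exists2 x, seq_mem x & (fun i => seq_norm (u i - x)) @ \oo --> (0 : R)
}.

Definition expands (l : banachSequenceSpace) (b : nat -> nat -> K^o)
    (c : nat -> K) (x : nat -> K^o) : Prop :=
  (fun n => seq_norm l (x - \sum_(i < n) c i *: b i)) @ \oo --> (0 : R).

Definition schauder_basis (l : banachSequenceSpace) (b : nat -> nat -> K^o) :
    Prop :=
  (forall n, l (b n)) /\ (forall x, l x -> exists! c, expands l b c x).

Definition unconditional_basis (l : banachSequenceSpace)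
    (b : nat -> nat -> K^o) : Prop :=
  schauder_basis l b /\
  forall x c, l x -> expands l b c x ->
    forall s : nat -> nat, bijective s -> expands l (b \o s) (c \o s) x.

(* The class $\Lambda$ *)
Record lambdaSpace := LambdaSpace {
  lambda_banach :> banachSequenceSpace;
  lambda_basis : unconditional_basis lambda_banach unit_sequence;
  lambda_monotone : forall x y, lambda_banach x -> lambda_banach y ->
    (forall n, modulus (x n) <= modulus (y n)) ->
    seq_norm lambda_banach x <= seq_norm lambda_banach y;
  lambda_unit : forall n, seq_norm lambda_banach (unit_sequence n) = 1
}.

End sequence_spaces.

Section kothe_space.
Variables (R : realType) (f : scalars).
Variables (l : lambdaSpace R f) (A : kotheMatrix R).
Local Notation K := (scalar R f).

Definition weighted (k : nat) (x : nat -> K^o) : nat -> K^o :=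
  fun n => x n * of_real f (A n k).

Definition is_kothe : {pred nat -> K^o} :=
  fun x => `[< forall k, l (weighted k x) >].

Lemma weighted0 k : weighted k 0 = 0.
Proof. by apply/funext => n; exact: mul0r. Qed.

Lemma weightedD k x y : weighted k (x + y) = weighted k x + weighted k y.
Proof. by apply/funext => n; exact: mulrDl. Qed.

Lemma weightedZ k a x : weighted k (a *: x) = a *: weighted k x.
Proof.
apply/funext => n; rewrite /weighted.
by rewrite -[(a *: x) n]/(a * x n) -mulrA.
Qed.

Fact is_kothe_closed : subsemimod_closed is_kothe.
Proof.
split; first split.
- by apply/asboolP => k; rewrite weighted0; exact: seq_mem0.
- move=> x y /asboolP lx /asboolP ly; apply/asboolP => k.
  by rewrite weightedD; exact: seq_memD.
- move=> a x /asboolP lx; apply/asboolP => k.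
  by rewrite weightedZ; exact: seq_memZ.
Qed.

HB.instance Definition _ :=
  GRing.isSubmodClosed.Build K (nat -> K^o) is_kothe is_kothe_closed.

Definition kothe_carrier : lmodType K := linear_subspace is_kothe.

Definition kothe_seminorm (k : nat) (x : kothe_carrier) : R :=
  seq_norm l (weighted k (inclusion x)).

Lemma kothe_mem k (x : kothe_carrier) : l (weighted k (inclusion x)).
Proof. by have /asboolP := linear_subspaceP x. Qed.

Fact kothe_seminormD k x y :
  kothe_seminorm k (x + y) <= kothe_seminorm k x + kothe_seminorm k y.
Proof.
rewrite /kothe_seminorm -[inclusion (x + y)]/(inclusion x + inclusion y).
by rewrite weightedD; apply: seq_normD; exact: kothe_mem.
Qed.

Fact kothe_seminormZ k a x :
  kothe_seminorm k (a *: x) = modulus a * kothe_seminorm k x.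
Proof.
rewrite /kothe_seminorm -[inclusion (a *: x)]/(a *: inclusion x).
by rewrite weightedZ; apply: seq_normZ; exact: kothe_mem.
Qed.

Fact kothe_seminorm_incr k x : kothe_seminorm k x <= kothe_seminorm k.+1 x.
Proof.
apply: lambda_monotone => [||n]; [exact: kothe_mem..|].
rewrite !modulusM ler_wpM2l ?modulus_ge0 // !modulus_of_real.
by rewrite !ger0_norm ?kothe_entry_ge0 // kothe_entry_incr.
Qed.

Definition kothe_graded : gradedSpace R f :=
  @GradedSpace R f kothe_carrier kothe_seminorm
    kothe_seminormD kothe_seminormZ kothe_seminorm_incr.

Lemma kothe_entry_gt0 n : exists k, 0 < A n k.
Proof.
have /ereal_sup_gt[_ [k _ <-]] := @kothe_entry_sup _ A n.
by rewrite lte_fin; exists k.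
Qed.

Lemma unit_sequence_mem n : l (@unit_sequence R f n).
Proof. by have [[]] := lambda_basis l. Qed.

Lemma modulus_coordinate_le (x : nat -> K^o) n :
  l x -> modulus (x n) <= seq_norm l x.
Proof.
move=> lx; have le := seq_memZ (x n) (unit_sequence_mem n).
rewrite -[leLHS]mulr1 -(lambda_unit l n) -seq_normZ; last first.
  exact: unit_sequence_mem.
apply: lambda_monotone => // j.
rewrite -[(_ *: _) j]/(x n * (j == n)%:R).
have [->|_] := eqVneq j n; first by rewrite mulr1.
by rewrite mulr0 modulus0 modulus_ge0.
Qed.

Fact kothe_hausdorff : hausdorff_space kothe_graded.
Proof.
apply: graded_hausdorffP => x x0; apply: val_inj; apply/funext => n /=.
have [k ank] := kothe_entry_gt0 n.
have : weighted k (inclusion x) n = 0.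
  have -> : weighted k (inclusion x) = 0.
    by apply: (@seq_norm_eq0 _ _ l _ (kothe_mem k x)); exact: x0.
  by [].
move=> /(congr1 (@modulus R f)); rewrite modulusM modulus_of_real modulus0.
move=> /eqP; rewrite mulf_eq0 normr_eq0 (gt_eqF ank) orbF => /eqP.
exact: modulus_eq0.
Qed.

Fact kothe_complete (u : nat -> kothe_graded) :
  cauchy (u @ \oo) -> cvg (u @ \oo).
Proof.
move=> /graded_cauchyP uc.
have /choice[y yP] k : exists y, l y /\
    (fun i => seq_norm l (weighted k (inclusion (u i)) - y)) @ \oo --> (0 : R).
  pose v i := weighted k (inclusion (u i)).
  have [i|e e0|y ly uy] := @seq_complete _ _ l v.
  - exact: kothe_mem.
  - have [N uN] := uc k e e0; exists N => i j Ni Nj.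
    have := uN i j Ni Nj; rewrite /seminorm /= /kothe_seminorm.
    rewrite -[inclusion (u i - u j)]/(inclusion (u i) - inclusion (u j)).
    by rewrite weightedD -[- inclusion (u j)]scaleN1r weightedZ scaleN1r.
  - by exists y.
have ly k : l (y k) by have [] := yP k.
have lB k i : l (weighted k (inclusion (u i)) - y k).
  by rewrite -scaleN1r; apply/seq_memD/seq_memZ/ly; exact: kothe_mem.
have uy k (e : R) : 0 < e -> exists N, forall i, (N <= i)%N ->
    seq_norm l (weighted k (inclusion (u i)) - y k) < e.
  move=> e0; have [_ /cvgrPdist_lt/(_ _ e0)[N _ uN]] := yP k.
  exists N => i /uN; rewrite sub0r normrN.
  by apply: le_lt_trans; exact: ler_norm.
have uyn k n (e : R) : 0 < e -> exists N, forall i, (N <= i)%N ->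
    modulus (inclusion (u i) n * of_real f (A n k) - y k n) < e.
  move=> /(uy k)[N uN]; exists N => i /uN; apply: le_lt_trans.
  exact: (modulus_coordinate_le n (lB k i)).
have ykm k m n : y k n * of_real f (A n m) = y m n * of_real f (A n k).
  apply/eqP; rewrite -subr_eq0; apply/eqP/modulus_eq0.
  apply/eqP; rewrite eq_le modulus_ge0 andbT; apply/ler_addgt0Pr => e e0.
  rewrite add0r.
  have d0 : 0 < A n k + A n m + 1.
    by rewrite ltr_pwDr // addr_ge0 ?kothe_entry_ge0.
  have ed0 := divr_gt0 e0 d0; set d := e / _ in ed0.
  have [M uM] := uyn k n d ed0; have [N uN] := uyn m n d ed0.
  pose i := maxn M N; pose z := inclusion (u i) n.
  have -> : y k n * of_real f (A n m) - y m n * of_real f (A n k) =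
      - ((z * of_real f (A n k) - y k n) * of_real f (A n m)) +
      (z * of_real f (A n m) - y m n) * of_real f (A n k).
    by ring.
  apply: (le_trans (modulusD _ _)); rewrite modulusN !modulusM !modulus_of_real.
  rewrite !ger0_norm ?kothe_entry_ge0 //.
  apply: (@le_trans _ _ (d * A n m + d * A n k)).
    rewrite lerD // ler_wpM2r ?kothe_entry_ge0 // ltW //.
      by apply: uM; exact: leq_maxl.
    by apply: uN; exact: leq_maxr.
  rewrite -mulrDr -mulrA ler_piMr ?ltW // mulrC ltr_pdivrMr // mul1r.
  by rewrite [ltLHS]addrC ltrDl.
have /choice[kk kkP] := kothe_entry_gt0.
pose x : nat -> K^o := fun n => y (kk n) n / of_real f (A n (kk n)).
have xy k : weighted k x = y k.
  apply/funext => n; rewrite /weighted /x mulrAC ykm mulfK //.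
  apply: contraTneq (kkP n) => /(congr1 (@modulus R f))/eqP.
  by rewrite modulus_of_real modulus0 normr_eq0 => /eqP ->; rewrite ltxx.
have xk : x \in is_kothe by apply/asboolP => k; rewrite xy.
apply/cvg_ex; exists (LinearSubspace xk : kothe_graded).
apply/graded_cvgP => k e /(uy k)[N uN]; exists N => i /uN.
rewrite seminormB /seminorm /= /kothe_seminorm.
rewrite -[inclusion (u i - _)]/(inclusion (u i) - x).
by rewrite weightedD -[- x]scaleN1r weightedZ scaleN1r xy.
Qed.

Definition kothe : frechetSpace R f :=
  FrechetSpace kothe_hausdorff kothe_complete.

End kothe_space.

Section nuclear_space.
Variables (R : realType) (f : scalars).
Local Notation K := (scalar R f).

Section local_banach_space.
Variable E : gradedSpace R f.

Definition localized (k : nat) : gradedSpace R f :=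
  @GradedSpace R f (graded_carrier E) (fun _ => @graded_seminorm R f E k)
    (fun _ => graded_seminormD k) (fun _ => graded_seminormZ k)
    (fun _ _ => lexx _).

(* Completion of $E / \ker \|\cdot\|_k$; all its seminorms are the norm. *)
Definition local_banach (k : nat) : frechetSpace R f :=
  completion (localized k).

Variables (k m : nat) (km : (k <= m)%N).

Fact linking_is_cauchy (u : linear_subspace (is_cauchy (G := localized m))) :
  (inclusion u : nat -> localized k) \in is_cauchy (G := localized k).
Proof.
have /is_cauchyP uc := linear_subspaceP u; apply/is_cauchyP => i e e0.
have [N uN] := uc i e e0; exists N => p q Np Nq.
apply: le_lt_trans (uN p q Np Nq).
exact: (@seminorm_incr R f E k m).
Qed.

(* The canonical map $E_m\to E_k$ induced by the identity of $E$ *)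
Definition linking_map (q : local_banach m) : local_banach k :=
  cauchy_class
    (LinearSubspace (linking_is_cauchy (repr (q : linear_quotient _)))).

Lemma linking_map_class (u : linear_subspace (is_cauchy (G := localized m))) :
  linking_map (cauchy_class u) =
  cauchy_class (LinearSubspace (linking_is_cauchy u)).
Proof.
rewrite /linking_map; set v := repr _.
have /is_nullP uv : v - u \in is_null (G := localized m).
  by apply/quotient_classE; rewrite quotient_reprK.
apply/quotient_classE/is_nullP => i e e0.
have [N uN] := uv i e e0; exists N => n Nn.
apply: le_lt_trans (uN n Nn).
exact: (@seminorm_incr R f E k m).
Qed.

Fact linking_map_linear : linear linking_map.
Proof.
move=> a p q; have [[u ->] [v ->]] := (cauchy_classP p, cauchy_classP q).
transitivity (linking_map (cauchy_class (a *: u + v))).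
  by rewrite -cauchy_classD -cauchy_classZ.
rewrite !linking_map_class.
transitivity (cauchy_class (a *: LinearSubspace (linking_is_cauchy u) +
   LinearSubspace (linking_is_cauchy v))).
  by congr cauchy_class; exact: val_inj.
by rewrite -cauchy_classD -cauchy_classZ.
Qed.

HB.instance Definition _ := GRing.isLinear.Build K (local_banach m)
  (local_banach k) _ linking_map linking_map_linear.

Lemma linking_map_embedding (x : E) :
  linking_map (@embedding R f (localized m) x) =
  @embedding R f (localized k) x.
Proof.
rewrite /embedding linking_map_class.
by congr cauchy_class; exact: val_inj.
Qed.

End local_banach_space.

Section nuclear_operator.
Variables (E : gradedSpace R f) (k m : nat).
Local Notation X := (local_banach E m).
Local Notation Y := (local_banach E k).

Definition dual_norm (g : X -> K^o) : \bar R :=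
  ereal_sup [set (modulus (g x))%:E | x in [set x | seminorm 0 x <= 1]].

(* $T=\sum_i g_i\otimes y_i$ with $\sum_i\|g_i\|\,\|y_i\|<\infty$; the index 0
   is immaterial, all seminorms of [X] and [Y] being equal. *)
Definition nuclear_operator (T : X -> Y) : Prop :=
  exists (g : nat -> {linear X -> K^o}) (y : nat -> Y),
  [/\ forall i, (dual_norm (g i) < +oo)%E,
      (\sum_(0 <= i <oo) dual_norm (g i) * (seminorm 0 (y i))%:E < +oo)%E &
      forall x, (fun n => \sum_(i < n) g i x *: y i) @ \oo --> T x].

End nuclear_operator.

Definition nuclear (E : gradedSpace R f) : Prop :=
  forall k, exists m, exists km : (k <= m)%N,
    nuclear_operator (@linking_map E k m km).

End nuclear_space.

(* Main.v *)
(* Uniform boundedness: if every continuous operator from a graded space E to a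
   Frechet space F is bounded, then a family of operators (T_i) with weighted
   equicontinuity estimates is bounded at a common level n (a gliding hump
   argument; this is the implication needed from Vogt's characterization of
   (E,F) in B).  Let T = Q o S.  Applied to the family y |-> Q (z (x) y) with
   weights |z|_q it gives |Q (z (x) y)|_r <= C |z|_s |y|_k with k independent
   of r.  Nuclearity of the second factor F at level k writes
   y = sum_i h_i(y) y_i with sum_i |h_i|_m |y_i|_k finite; applied to the slices
   (id (x) h_i) o S it gives |(id (x) h_i)(S x)|_s <= C |h_i|_m |x|_n with n
   independent of s.  Since S x = sum_i (id (x) h_i)(S x) (x) y_i at level k,
   |T x|_r <= C C' (sum_i |h_i|_m |y_i|_k) |x|_n. *)

From HB Require Import structures.
Require Import Defs.
From mathcomp Require Import all_boot all_order all_algebra.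
From mathcomp Require Import complex ring lra.
From mathcomp Require Import all_classical all_reals all_analysis.

Set Implicit Arguments.
Unset Strict Implicit.
Unset Printing Implicit Defensive.

Import Order.TTheory GRing.Theory Num.Theory.
Import numFieldNormedType.Exports.
Local Open Scope classical_set_scope.
Local Open Scope ring_scope.

(** * Seminorm estimates for continuous and bounded operators *)

Section operator_bounds.
Variables (R : realType) (f : scalars).
Local Notation K := (Defs.scalar R f).
Implicit Types E F : gradedSpace R f.

(** Dividing [x] by [psi x] puts it in the unit ball. If [psi x = 0], every multiple of [x] lies
    there, so a positive [phi x] could be scaled past [C]. *)
Lemma homogeneous_bound (V : lmodType K) (phi psi : V -> R) (C : R) :
  (forall a x, phi (a *: x) = modulus a * phi x) ->
  (forall a x, psi (a *: x) = modulus a * psi x) ->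
  (forall x, 0 <= psi x) ->
  (forall x, psi x <= 1 -> phi x <= C) -> forall x, phi x <= C * psi x.
Proof.
move=> phiZ psiZ psi0 phiC x; have := psi0 x.
rewrite le_eqVlt => /orP[/eqP x0|x0].
  rewrite -x0 mulr0 leNgt; apply/negP => px0.
  have := phiC (of_real f ((`|C| + 1) / phi x) *: x).
  rewrite psiZ -x0 mulr0 ler01 => /(_ isT).
  have d0 : 0 < (`|C| + 1) / phi x by rewrite divr_gt0 // ltr_wpDl.
  rewrite phiZ modulus_of_real (gtr0_norm d0) divfK ?gt_eqF //.
  by have := ler_norm C; lra.
have i0 : 0 < (psi x)^-1 by rewrite invr_gt0.
have := phiC (of_real f (psi x)^-1 *: x).
rewrite psiZ phiZ modulus_of_real (gtr0_norm i0) mulVf ?gt_eqF // lexx.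
by move=> /(_ isT); rewrite mulrC ler_pdivrMr.
Qed.

Lemma seminorm_linear_bound E F (T : {linear E -> F}) p q (C : R) :
  (forall x, seminorm q x <= 1 -> seminorm p (T x) <= C) ->
  forall x, seminorm p (T x) <= C * seminorm q x.
Proof.
apply: (@homogeneous_bound E (fun x => seminorm p (T x)) (seminorm q)).
- by move=> a x; rewrite linearZ seminormZ.
- exact: seminormZ.
- exact: seminorm_ge0.
Qed.

Lemma continuous_seminorm E F (T : {linear E -> F}) : continuous T ->
  forall p, exists q (C : R), 0 <= C /\
    forall x, seminorm p (T x) <= C * seminorm q x.
Proof.
move=> Tc p; have : nbhs (T 0) [set y | seminorm p (T 0 - y) < 1].
  by apply/graded_nbhsP; exists p, 1.
move=> /(Tc 0)/graded_nbhsP[q [e e0 qT]].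
(* Multiplication by [e / 2] sends the closed unit ball strictly inside the open ball of radius [e];
   the constant is the inverse factor. *)
exists q, (2 / e); split; first by rewrite divr_ge0 // ltW.
pose a := of_real f (e / 2); have a0 : 0 < e / 2 by rewrite divr_gt0.
move=> x; have aE : modulus a = e / 2 by rewrite modulus_of_real gtr0_norm.
have : seminorm p (T x) <= (e / 2)^-1 * seminorm q x.
  apply: seminorm_linear_bound => y y1.
  have := qT (a *: y); rewrite sub0r seminormN seminormZ aE /= linear0 linearZ.
  rewrite sub0r seminormN seminormZ aE -[X in _ -> _ <= X]mulr1 ler_pdivlMl //.
  move=> ye; apply/ltW/ye/(le_lt_trans (ler_wpM2l (ltW a0) y1)).
  by rewrite mulr1; lra.
by rewrite invf_div.
Qed.

Lemma seminorm_continuous E F (T : {linear E -> F}) :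
  (forall p, exists q (C : R), forall x,
    seminorm p (T x) <= C * seminorm q x) -> continuous T.
Proof.
move=> Tb x A /graded_nbhsP[p [e e0 pA]].
have [q [C Tq]] := Tb p.
have c0 : 0 < `|C| + 1 by rewrite ltr_wpDl.
apply/graded_nbhsP; exists q, (e / (`|C| + 1)); first by rewrite divr_gt0.
move=> y; rewrite ltr_pdivlMr // => xy; apply: pA; rewrite -linearB.
apply: le_lt_trans xy; apply: (le_trans (Tq _)).
by rewrite mulrC ler_wpM2l ?seminorm_ge0 //; have := ler_norm C; lra.
Qed.

Lemma bounded_operatorP E F (T : {linear E -> F}) :
  bounded_operator T <-> exists n, forall r, exists C : R,
    forall x, seminorm r (T x) <= C * seminorm n x.
Proof.
split=> -[n Tn]; exists n => r; last first.
  have [C TC] := Tn r; apply: (@le_lt_trans _ _ `|C|%:E); last exact: ltry.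
  apply: ge_ereal_sup => _ [x /= x1 <-]; rewrite lee_fin.
  apply: (le_trans (TC x)); apply: (le_trans (ler_wpM2r _ (ler_norm C))).
    exact: seminorm_ge0.
  by rewrite ler_piMr.
have ub x : seminorm n x <= 1 ->
    ((seminorm r (T x))%:E <= operator_seminorm T r n)%E.
  by move=> x1; apply: ereal_sup_ubound; exists x.
have := Tn r; case: (operator_seminorm T r n) ub => [C|//|] ub _.
  by exists C; apply: seminorm_linear_bound => x /ub; rewrite lee_fin.
(* The supremum is not [-oo], because the unit ball contains 0. *)
by have := ub 0; rewrite seminorm0 ler01 => /(_ isT).
Qed.

Lemma graded_cvgD E (u v : nat -> E) a x y : u @ \oo --> x -> v @ \oo --> y ->
  (fun n => a *: u n + v n) @ \oo --> a *: x + y.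
Proof.
move=> /graded_cvgP ux /graded_cvgP vy; apply/graded_cvgP => k e e0.
have a0 : 0 < modulus a + 1 by rewrite ltr_wpDl // modulus_ge0.
have e20 : 0 < e / 2 by exact: divr_gt0.
have [M uM] := ux k _ (divr_gt0 e20 a0); have [N vN] := vy k _ e20.
exists (maxn M N) => n; rewrite geq_max => /andP[Mn Nn].
rewrite opprD addrACA -scalerBr [e]splitr.
apply: (le_lt_trans (seminormD _ _ _)); apply: ltr_leD; last exact/ltW/vN.
rewrite seminormZ; have := uM n Mn; rewrite ltr_pdivlMr // mulrC.
by apply: le_lt_trans; rewrite ler_wpM2r ?seminorm_ge0 // lerDl.
Qed.

Lemma cvg_seminorm E (u : nat -> E) x k : u @ \oo --> x ->
  (fun n => seminorm k (u n)) @ \oo --> seminorm k x.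
Proof.
move=> /graded_cvgP ux; apply/cvgrPdist_lt => e /(ux k)[N uN].
by exists N => // n /uN; apply: le_lt_trans; exact: seminorm_dist.
Qed.

Lemma frechet_limit_unique (F : frechetSpace R f) (u : nat -> F)
  (x y : F) :
  u @ \oo --> x -> u @ \oo --> y -> x = y.
Proof.
move=> ux uy; exact: (cvg_unique (@frechet_hausdorff R f F) ux uy).
Qed.

End operator_bounds.

(** * Gliding hump and uniform boundedness of weighted families *)

Section uniform_boundedness.
Variables (R : realType) (f : scalars).
Local Notation K := (Defs.scalar R f).

Lemma linear_function (U V : lmodType K) (g : U -> V) :
  linear g -> exists T : {linear U -> V}, forall x, T x = g x.
Proof.
move=> gl; pose m := GRing.isLinear.Build K U V _ g gl.
by exists (HB.pack_for {linear U -> V} g m).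
Qed.

Lemma linear_limit (E : gradedSpace R f) (F : frechetSpace R f)
    (u : nat -> {linear E -> F}) (g : E -> F) :
  (forall x, (fun n => u n x) @ \oo --> g x) ->
  exists T : {linear E -> F}, forall x, T x = g x.
Proof.
move=> ug; apply: linear_function => a x y.
apply: (frechet_limit_unique (ug _)).
under eq_fun do rewrite linearP.
exact: graded_cvgD.
Qed.

Lemma seminorm_sum (E : gradedSpace R f) k n (v : nat -> E) :
  seminorm k (\sum_(i < n) v i) <= \sum_(i < n) seminorm k (v i).
Proof.
elim: n => [|n IH]; first by rewrite !big_ord0 seminorm0.
by rewrite !big_ord_recr /=; apply: (le_trans (seminormD _ _ _));
  rewrite lerD2r.
Qed.

(** Keeping the subtracted term in the bound makes it telescope, so that the induction on [m - n]
    closes. *)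
Lemma geometric_sum_le (E : gradedSpace R f) k n m (v : nat -> E) (B : R) :
  (forall s, (n <= s)%N -> seminorm k (v s) <= B / 2 ^+ s) -> (n <= m)%N ->
  seminorm k (\sum_(i < m) v i - \sum_(i < n) v i) <=
    2 * B / 2 ^+ n - 2 * B / 2 ^+ m.
Proof.
move=> vB /subnK <-; elim: (m - n)%N => [|d IH].
  by rewrite !add0n !subrr seminorm0.
rewrite addSn big_ord_recr /= addrAC; apply: (le_trans (seminormD _ _ _)).
apply: (le_trans (lerD IH (vB _ (leq_addl _ _)))).
rewrite exprS invfM; set t := (2 ^+ (d + n))^-1.
have -> : 2 * B * (2^-1 * t) = B * t by field.
by lra.
Qed.

(** Smallness at level [p] is required from index [p] on only, which is what a diagonal construction
    provides; each seminorm still sees a geometric tail. *)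
Lemma geometric_series (F : frechetSpace R f) (v : nat -> F) (B : nat -> R) :
  (forall p, 0 <= B p) ->
  (forall p s, (p <= s)%N -> seminorm p (v s) <= B p / 2 ^+ s) ->
  exists y : F, (fun n => \sum_(i < n) v i) @ \oo --> y /\
    forall p n, (p <= n)%N ->
      seminorm p (y - \sum_(i < n) v i) <= 2 * B p / 2 ^+ n.
Proof.
move=> B0 vB; pose u n := \sum_(i < n) v i.
have uB p n m : (p <= n)%N -> (n <= m)%N ->
    seminorm p (u m - u n) <= 2 * B p / 2 ^+ n.
  move=> pn nm; apply: (le_trans (geometric_sum_le (B := B p) _ nm)).
    by move=> s ns; apply: vB; exact: leq_trans ns.
  by rewrite gerBl !mulr_ge0 ?invr_ge0 ?exprn_ge0.
have small p (e : R) : 0 < e ->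
    exists n, (p <= n)%N /\ 2 * B p / 2 ^+ n < e.
  move=> e0; exists (maxn p (Num.truncn (2 * B p / e)).+1).
  rewrite leq_maxl; split=> //; set n := maxn _ _.
  rewrite ltr_pdivrMr ?exprn_gt0 // [ltRHS]mulrC -ltr_pdivrMr //.
  apply: (lt_le_trans (truncnS_gt _)).
  apply: (@le_trans _ _ n%:R); first by rewrite ler_nat; exact: leq_maxr.
  by rewrite -natrX ler_nat ltnW // ltn_expl.
have /cvg_ex[y uy] : cvg (u @ \oo).
  apply: (@frechet_complete _ _ F); apply/graded_cauchyP => p e e0.
  have [n [pn ne]] := small p (e / 2) (divr_gt0 e0 (ltr0Sn _ 1)).
  exists n => a b na nb; apply: (le_lt_trans (seminorm_tri p _ (u n) _)).
  rewrite [e]splitr ltrD ?(le_lt_trans (uB p n _ pn _)) //.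
  by rewrite seminormB (le_lt_trans (uB p n _ pn _)).
exists y; split=> // p n pn.
apply/ler_addgt0Pr => e e0.
have /graded_cvgP/(_ p e e0)[M yM] := uy.
rewrite [leRHS]addrC; apply: (le_trans (seminorm_tri p _ (u (maxn M n)) _)).
rewrite lerD //; first exact/ltW/yM/leq_maxl.
by apply: uB => //; exact: leq_maxr.
Qed.

(** With [W] the weight of an operator, [X] the seminorm of a vector and [t] that of its image, a
    violated estimate yields a small coefficient [a] and a vector scaled by [b] into the unit ball
    whose image stays large. The natural factors [e / W] and [1 / X] may be undefined, so both
    denominators are enlarged by some [d] that the strict inequality leaves room for. *)
Lemma rescaling (W X t e M : R) : 0 <= W -> 0 <= X -> 0 < e -> 0 < M ->
  M / e * W * X < t -> exists a b : R,
    [/\ 0 < a, 0 < b, b * X <= 1, a * W <= e & M <= a * (b * t)].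
Proof.
move=> W0 X0 e0 M0 tb.
have g0 : 0 < t * (e / M) - W * X.
  rewrite subr_gt0 -ltr_pdivrMr ?divr_gt0 // invf_div.
  by rewrite mulrC mulrA.
have s0 : 0 < W + X + 1 by rewrite ltr_wpDl // addr_ge0.
(* As [d <= 1], [(W + d) * (X + d) <= W * X + d * (W + X + 1) <= t * (e / M)]. *)
pose d := Num.min 1 ((t * (e / M) - W * X) / (W + X + 1)).
have d0 : 0 < d by rewrite lt_min ltr01 divr_gt0.
have d1 : d <= 1 by rewrite ge_min lexx.
have dg : d * (W + X + 1) <= t * (e / M) - W * X.
  by rewrite -ler_pdivlMr // ge_min lexx orbT.
have Wd : 0 < W + d by rewrite ltr_wpDl.
have Xd : 0 < X + d by rewrite ltr_wpDl.
exists (e / (W + d)), (X + d)^-1; split.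
- by rewrite divr_gt0.
- by rewrite invr_gt0.
- by rewrite mulrC ler_pdivrMr // mul1r lerDl ltW.
- by rewrite mulrAC ler_pdivrMr // ler_wpM2l ?(ltW e0) // lerDl ltW.
- have -> : e / (W + d) * ((X + d)^-1 * t) =
      M * (t * (e / M)) / ((W + d) * (X + d)).
    by field; rewrite !gt_eqF.
  rewrite ler_pdivlMr ?mulr_gt0 // ler_wpM2l ?(ltW M0) //.
  have : d * d <= d by rewrite ler_piMl // ltW.
  by lra.
Qed.

Lemma of_real2 : of_real f 2 = 2 :> K.
Proof. by case: f => //=; exact: (rmorph_nat (real_complex R) 2). Qed.

(** Since [2 y = (x + y) - (x - y)], a suitable sign keeps a new term [y] from being cancelled by
    the sum [x] of the old ones. *)
Lemma seminorm_sign (E : gradedSpace R f) k (x y : E) :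
  seminorm k y <= seminorm k (x + y) \/ seminorm k y <= seminorm k (x - y).
Proof.
have : seminorm k (of_real f 2 *: y) <= seminorm k (x + y) + seminorm k (x - y).
  have -> : of_real f 2 *: y = (x + y) - (x - y).
    by rewrite of_real2 scaler_nat opprB addrC addrA subrK -mulr2n.
  by apply: (le_trans (seminormD _ _ _)); rewrite seminormN.
rewrite seminormZ modulus_of_real ger0_norm // => h.
by case: (leP (seminorm k y) (seminorm k (x + y))) => c; [left|right; lra].
Qed.

(** The 2-adic valuation of [s + 1] takes every value infinitely often and never exceeds [s], so
    each seminorm index is tested at arbitrarily late stages. *)
Definition level s := logn 2 s.+1.

Lemma level_le s : (level s <= s)%N.
Proof. by rewrite -ltnS ltn_logl. Qed.

Lemma level_unbounded n m : exists2 s, (m <= s)%N & level s = n.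
Proof.
have g0 : (0 < 2 ^ n * m.*2.+1)%N by rewrite muln_gt0 expn_gt0.
exists (2 ^ n * m.*2.+1).-1.
  rewrite -ltnS prednK // (leq_trans _ (leq_pmull _ _)) ?expn_gt0 //.
  by rewrite ltnS -addnn leq_addr.
rewrite /level prednK // lognM ?expn_gt0 // pfactorK //.
by rewrite logn_coprime ?addn0 // coprime2n /= odd_double.
Qed.

(** If the conclusion fails, one builds a continuous [T0 = \sum_s c_s T_(i_s)] and vectors [x_s]
    with [|x_s|_(level s) <= 1] and [|T0 x_s|_(r s) >= s]. The index [r s] depends only on
    [level s], and each level recurs infinitely often, so [T0] is bounded at no level. *)
Theorem all_bounded_uniform (E : gradedSpace R f) (F : frechetSpace R f)
    (I : Type) (T : I -> {linear E -> F}) (w : I -> nat -> R) :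
  all_bounded E F ->
  (forall i q, 0 <= w i q) -> (forall i q, w i q <= w i q.+1) ->
  (forall p, exists N C, 0 <= C /\ forall i x,
    seminorm p (T i x) <= C * w i N * seminorm N x) ->
  exists n, forall r, exists q C, forall i x,
    seminorm r (T i x) <= C * w i q * seminorm n x.
Proof.
move=> EF w0 wS /choice[N /choice[C TC]].
have C0 p : 0 <= C p by have [] := TC p.
have TN p i x : seminorm p (T i x) <= C p * w i (N p) * seminorm (N p) x.
  by have [_] := TC p.
have wle i p q : (p <= q)%N -> w i p <= w i q.
  move=> /subnK <-; elim: (q - p)%N => [|d IH]; first by rewrite add0n.
  by apply: (le_trans IH); rewrite addSn.
apply: contrapT => nb.
(* [rr n] is an output seminorm that no weight index and no constant control by level [n]. *)
have /choice[rr rrP] n : exists r, forall q c, exists i x,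
    c * w i q * seminorm n x < seminorm r (T i x).
  apply: contrapT => nr; apply: nb; exists n => r.
  apply: contrapT => nq; apply: nr; exists r => q c.
  apply: contrapT => ni; apply: nq; exists q, c => i x.
  by rewrite leNgt; apply/negP => ix; apply: ni; exists i, x.
(* A stage consists of an index, a coefficient and a test vector. A history [h] lists the earlier
   stages, latest first; its length is the number of the current stage. *)
pose D := (I * K * E)%type.
pose term (d : D) (x : E) : F := d.1.2 *: T d.1.1 x.
pose U (h : seq D) x := \sum_(d <- h) term d x.
(* A sum serves as a common upper bound of [N p] and [N (rr p)] for [p <= s]. *)
pose Q s := (\sum_(p < s.+1) (N p + N (rr p)))%N.
have QN p s : (p <= s)%N -> (N p <= Q s)%N.
  move=> ps; rewrite /Q (bigD1 (Ordinal (ps : (p < s.+1)%N))) //=.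
  by rewrite -!addnA leq_addr.
have Qr p s : (p <= s)%N -> (N (rr p) <= Q s)%N.
  move=> ps; rewrite /Q (bigD1 (Ordinal (ps : (p < s.+1)%N))) //=.
  by rewrite -addnA addnCA leq_addr.
(* The summand 1 makes the series converge; the other sum makes the new term small on all earlier
   test vectors. *)
pose size_cond (h : seq D) (d : D) := modulus d.1.2 * w d.1.1 (Q (size h)) *
  (1 + \sum_(d' <- h) seminorm (Q (size h)) d'.2) <= (2 ^+ size h)^-1.
pose r s := rr (level s).
(* The reserve [2 * C] absorbs what later terms contribute on this test vector. *)
pose Phi (h : seq D) (d : D) := [/\ seminorm (level (size h)) d.2 <= 1,
  size_cond h d &
  (size h)%:R + 2 * C (r (size h)) <= seminorm (r (size h)) (U (d :: h) d.2)].
have /choice[step stepP] h : exists d, Phi h d.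
  set s := size h; set M := s%:R + 2 * C (r s).
  pose H := 1 + \sum_(d' <- h) seminorm (Q s) d'.2.
  have H0 : 0 < H.
    by rewrite ltr_wpDr // sumr_ge0 // => d _; exact: seminorm_ge0.
  have e0 : 0 < (2 ^+ s)^-1 / H by rewrite divr_gt0 // invr_gt0 exprn_gt0.
  (* [M] may be 0, whereas [rescaling] needs a positive target. *)
  have M0 : 0 < M + 1 by rewrite ltr_wpDl // addr_ge0 // mulr_ge0.
  have [i [x ix]] := rrP (level s) (Q s) ((M + 1) / ((2 ^+ s)^-1 / H)).
  have [a [b [a0 b0 bx aw ab]]] :=
    rescaling (w0 i (Q s)) (seminorm_ge0 (level s) x) e0 M0 ix.
  pose x' : E := of_real f b *: x; pose a' : K := of_real f a.
  have ma : modulus a' = a by rewrite modulus_of_real gtr0_norm.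
  have mb : modulus (of_real f b) = b by rewrite modulus_of_real gtr0_norm.
  have x1 : seminorm (level s) x' <= 1 by rewrite seminormZ mb.
  have ax : M <= seminorm (r s) (a' *: T i x').
    by rewrite linearZ !seminormZ ma mb; apply: le_trans ab; rewrite lerDl.
  have sz c : modulus c = a -> size_cond h (i, c, x').
    by move=> ca; rewrite /size_cond /= -/s -/H ca -ler_pdivlMr.
  have UE c : U ((i, c, x') :: h) x' = U h x' + c *: T i x'.
    by rewrite /U big_cons addrC.
  (* The sign of the coefficient is free, because [size_cond] sees only its modulus. *)
  have [le|le] := seminorm_sign (r s) (U h x') (a' *: T i x').
    exists (i, a', x'); split=> //; first exact: sz.
    by rewrite UE; exact: (le_trans ax le).
  exists (i, - a', x'); split=> //; first by apply: sz; rewrite modulusN.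
  by rewrite UE scaleNr; exact: (le_trans ax le).
pose hist := fix hist s :=
  if s is s'.+1 then step (hist s') :: hist s' else [::].
have size_hist s : size (hist s) = s by elim: s => //= s ->.
pose d s := step (hist s).
have dP s : Phi (hist s) (d s) := stepP _.
have sum_hist (V : nmodType) (g : D -> V) s :
    \sum_(d' <- hist s) g d' = \sum_(j < s) g (d j).
  elim: s => [|s IH]; first by rewrite big_nil big_ord0.
  by rewrite big_cons IH big_ord_recr addrC.
have small s : modulus (d s).1.2 * w (d s).1.1 (Q s) *
    (1 + \sum_(j < s) seminorm (Q s) (d j).2) <= (2 ^+ s)^-1.
  by have [_ + _] := dP s; rewrite /size_cond sum_hist size_hist.
have mw0 s q : 0 <= modulus (d s).1.2 * w (d s).1.1 q.
  by rewrite mulr_ge0 ?modulus_ge0.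
have term_le p s x : seminorm p (term (d s) x) <=
    C p * seminorm (N p) x * (modulus (d s).1.2 * w (d s).1.1 (N p)).
  rewrite seminormZ; apply: (le_trans (ler_wpM2l (modulus_ge0 _) (TN p _ x))).
  by rewrite le_eqVlt; apply/orP; left; apply/eqP; ring.
have sumx0 s q : 0 <= \sum_(j < s) seminorm q (d j).2.
  by apply: sumr_ge0 => j _; exact: seminorm_ge0.
have coef_le p s : (p <= s)%N ->
    modulus (d s).1.2 * w (d s).1.1 (N p) <= (2 ^+ s)^-1.
  move=> ps; apply: le_trans (small s).
  apply: (le_trans (ler_wpM2l (modulus_ge0 _) (wle _ _ _ (QN p s ps)))).
  by rewrite ler_peMr // lerDl.
(* As [level s <= s < t], the index [N (r s)] is below [Q t], and the summand [j = s] in [small t]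
   gives the bound. *)
have past_le s t : (s < t)%N ->
    seminorm (r s) (term (d t) (d s).2) <= C (r s) / 2 ^+ t.
  move=> st; have lt : (level s <= t)%N.
    exact: leq_trans (level_le s) (ltnW st).
  apply: (le_trans (term_le _ _ _)); rewrite -mulrA ler_wpM2l //.
  apply: le_trans (small t); rewrite mulrC ler_pM ?seminorm_ge0 //.
    by rewrite ler_wpM2l ?modulus_ge0 // wle // Qr.
  apply: (le_trans (seminorm_incr _ (Qr _ _ lt))).
  rewrite (bigD1 (Ordinal st)) //= addrCA lerDl addr_ge0 // sumr_ge0 // => j _.
  exact: seminorm_ge0.
have /choice[g gP] x : exists y : F,
    (fun n => \sum_(i < n) term (d i) x) @ \oo --> y /\
    forall p n, (p <= n)%N -> seminorm p (y - \sum_(i < n) term (d i) x) <=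
      2 * (C p * seminorm (N p) x) / 2 ^+ n.
  apply: (@geometric_series F (fun s => term (d s) x)
    (fun p => C p * seminorm (N p) x)) => [p|p s ps].
    by rewrite mulr_ge0 ?seminorm_ge0.
  apply: (le_trans (term_le _ _ _)); rewrite ler_wpM2l ?coef_le //.
  by rewrite mulr_ge0 ?seminorm_ge0.
have /choice[u uE] n : exists u : {linear E -> F},
    forall x, u x = \sum_(i < n) term (d i) x.
  apply: (linear_function (g := fun x => \sum_(i < n) term (d i) x)) => a x y.
  rewrite scaler_sumr -big_split /=.
  apply: eq_bigr => i _; rewrite /term linearP scalerDr !scalerA.
  by rewrite [a * _]mulrC.
have [T0 T0E] : exists T0 : {linear E -> F}, forall x, T0 x = g x.
  apply: (@linear_limit E F u g) => x; have [gx _] := gP x.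
  by under eq_fun do rewrite uE.
have T0c : continuous T0.
  apply: seminorm_continuous => p.
  (* The geometric estimate at level [p] starts at index [p]; the first [p] terms are bounded one by
     one. *)
  exists (N p), (2 * C p / 2 ^+ p + \sum_(i < p) C p *
    (modulus (d i).1.2 * w (d i).1.1 (N p))) => x.
  rewrite T0E -[g x](subrK (\sum_(i < p) term (d i) x)) mulrDl.
  apply: (le_trans (seminormD _ _ _)); apply: lerD.
    have [_ /(_ p p (leqnn _))] := gP x; congr (_ <= _); ring.
  apply: (le_trans (@seminorm_sum F p p (fun i => term (d i) x))).
  rewrite mulr_suml.
  by apply: ler_sum => i _; rewrite mulrAC.
have [n0 T0b] := (bounded_operatorP _).1 (EF T0 T0c).
have [c Tc] := T0b (rr n0).
(* A stage testing the level [n0] of [T0], late enough that [s] exceeds [|c|]. *)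
have [s cs sn] := level_unbounded n0 (Num.truncn `|c|).+1.
have [x1 _] := dP s; rewrite size_hist in x1 *.
rewrite -[_ :: _]/(hist s.+1) /U sum_hist.
have rs : r s = rr n0 by rewrite /r sn.
have tail : seminorm (r s) (g (d s).2 - \sum_(i < s.+1) term (d i) (d s).2) <=
    2 * C (r s) / 2 ^+ s.+1.
  have [gx _] := gP (d s).2; apply/ler_addgt0Pr => e e0.
  have /graded_cvgP/(_ (r s) e e0)[m gm] := gx.
  rewrite [leRHS]addrC.
  pose v i := \sum_(j < i) term (d j) (d s).2.
  apply: (le_trans (seminorm_tri _ _ (v (maxn m s.+1)) _)).
  rewrite lerD //; first exact/ltW/gm/leq_maxl.
  apply: (le_trans (@geometric_sum_le F (r s) s.+1 _
    (fun j => term (d j) (d s).2) (C (r s)) _ (leq_maxr _ _))).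
    by move=> t; exact: past_le.
  by rewrite gerBl !mulr_ge0 ?invr_ge0 ?exprn_ge0.
have half : 2 * C (r s) / 2 ^+ s.+1 <= 2 * C (r s).
  by rewrite ler_piMr ?mulr_ge0 // invf_le1 ?exprn_gt0 // exprn_ege1 // ler1n.
have bd : seminorm (r s) (g (d s).2) <= `|c|.
  rewrite -T0E rs; apply: (le_trans (Tc _)).
  rewrite sn in x1.
  apply: (le_trans (ler_wpM2r (seminorm_ge0 _ _) (ler_norm c))).
  by rewrite ler_piMr.
move=> big.
(* The partial sum is at least [s + 2 C] by choice of stage [s], yet at most [2 C + |c|], which is
   smaller. *)
have : seminorm (r s) (\sum_(i < s.+1) term (d i) (d s).2) <=
    seminorm (r s) (g (d s).2 - \sum_(i < s.+1) term (d i) (d s).2) +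
    seminorm (r s) (g (d s).2).
  rewrite seminormB; apply: le_trans (seminormD _ _ _).
  by rewrite subrK.
have : `|c| < s%:R.
  by apply: (lt_le_trans (truncnS_gt _)); rewrite ler_nat.
by lra.
Qed.

End uniform_boundedness.

(** * Extension to completions, and slices of tensors *)

Section completed_tensor_product.
Variables (R : realType) (f : scalars).
Local Notation K := (Defs.scalar R f).

(** The value at the class of [u] is the limit of [L (u n)]: the estimates send Cauchy sequences to
    Cauchy sequences and null sequences to null sequences, and they pass to the limit with the same
    constants. *)
Lemma completion_extension (G : gradedSpace R f) (F : frechetSpace R f)
    (L : {linear G -> F}) (N : nat -> nat) (C : nat -> R) :
  (forall p, 0 <= C p) ->
  (forall p x, seminorm p (L x) <= C p * seminorm (N p) x) ->
  exists L' : {linear completion G -> F},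
    (forall x, L' (@embedding R f G x) = L x) /\
    forall p u, seminorm p (L' u) <= C p * seminorm (N p) u.
Proof.
move=> C0 LC.
have /choice[l lP] (u : linear_subspace (is_cauchy (G := G))) :
    exists y : F, (fun n => L (inclusion u n)) @ \oo --> y.
  apply/cvg_ex; apply: (@frechet_complete _ _ F).
  apply/graded_cauchyP => p e e0.
  have /is_cauchyP uc := linear_subspaceP u.
  have c0 : 0 < C p + 1 by rewrite ltr_wpDl.
  have [M uM] := uc (N p) _ (divr_gt0 e0 c0); exists M => m n Mm Mn.
  rewrite -linearB; apply: (le_lt_trans (LC _ _)).
  apply: le_lt_trans (_ : (C p + 1) * seminorm (N p) _ < _).
    by apply: ler_wpM2r; [exact: seminorm_ge0|rewrite lerDl].
  by rewrite mulrC -ltr_pdivlMr // uM.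
pose g (q : completion G) := l (repr (q : linear_quotient _)).
have gP u : (fun n => L (inclusion u n)) @ \oo --> g (cauchy_class u).
  rewrite /g; set v := repr _.
  have /is_nullP uv : u - v \in is_null (G := G).
    by apply/quotient_classE; rewrite quotient_reprK.
  have uv0 : (fun n => L (inclusion (u - v) n)) @ \oo --> (0 : F).
    apply/graded_cvgP => p e e0; have c0 : 0 < C p + 1 by rewrite ltr_wpDl.
    have [M uM] := uv (N p) _ (divr_gt0 e0 c0); exists M => n Mn.
    rewrite sub0r seminormN; apply: (le_lt_trans (LC _ _)).
    apply: le_lt_trans (_ : (C p + 1) * seminorm (N p) _ < _).
      by apply: ler_wpM2r; [exact: seminorm_ge0|rewrite lerDl].
    by rewrite mulrC -ltr_pdivlMr // uM.
  have := graded_cvgD (a := 1) uv0 (lP v); rewrite scaler0 add0r.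
  have -> // : (fun n => 1 *: L (inclusion (u - v) n) + L (inclusion v n)) =
      (fun n => L (inclusion u n)).
  apply/funext => n; rewrite scale1r -linearD; congr (L _).
  exact: (subrK (inclusion v n) (inclusion u n)).
have [L' L'E] : exists L' : {linear completion G -> F}, forall q, L' q = g q.
  apply: linear_function => a p q.
  have [[u ->] [v ->]] := (cauchy_classP p, cauchy_classP q).
  rewrite cauchy_classZ cauchy_classD.
  apply: (frechet_limit_unique (gP _)).
  have -> : (fun n => L (inclusion (a *: u + v) n)) =
      (fun n => a *: L (inclusion u n) + L (inclusion v n)).
    by apply/funext => n; rewrite -linearP.
  exact: graded_cvgD.
exists L'; split=> [x|p q]; rewrite L'E.
  apply: (frechet_limit_unique (gP (LinearSubspace (const_is_cauchy x)))).
  by apply/graded_cvgP => k e e0; exists 0%N => n _; rewrite subrr seminorm0.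
have [u ->] := cauchy_classP q.
have uc := @completion_seminorm_class R f G (N p) u.
apply: (ler_cvg_to (cvg_seminorm (k := p) (gP u)) (cvgM (cvg_cst (C p)) uc)).
by apply: nearW => n; exact: LC.
Qed.

Definition product_form (E F : gradedSpace R f) (phi : {linear E -> K^o})
  (g : {linear F -> K^o}) : E -> F -> K^o := fun x y => phi x * g y.

Section product_form_bilinear.
Variables (E F : gradedSpace R f).
Variables (phi : {linear E -> K^o}) (g : {linear F -> K^o}).

Fact product_form_zmodl y : zmod_morphism ((product_form phi g)^~ y).
Proof. by move=> x x'; rewrite /product_form linearB mulrBl. Qed.

Fact product_form_zmodr x : zmod_morphism (product_form phi g x).
Proof. by move=> y y'; rewrite /product_form linearB mulrBr. Qed.

Fact product_form_scalel y :
  scalable_for *:%R ((product_form phi g)^~ y).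
Proof. by move=> a x; rewrite /product_form linearZ -mulrA. Qed.

Fact product_form_scaler x : scalable_for *:%R (product_form phi g x).
Proof. by move=> a y; rewrite /product_form linearZ mulrCA. Qed.

HB.instance Definition _ := isBilinear.Build K E F K^o *:%R *:%R
  (product_form phi g) product_form_zmodl product_form_zmodr
  product_form_scalel product_form_scaler.

End product_form_bilinear.

(** Tensors being functionals on bilinear forms, product forms turn an equality of tensors into an
    equality of slices under each [phi]. *)
Lemma tensor_sum_product_form (E F : gradedSpace R f) (phi : {linear E -> K^o})
    (g : {linear F -> K^o}) (s : seq (E * F)) :
  tensor_sum s (product_form phi g : bilinear_form E F) =
    phi (\sum_(z <- s) g z.2 *: z.1).
Proof.
rewrite /tensor_sum fct_sumE linear_sum; apply: eq_bigr => z _.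
by rewrite linearZ /elementary_tensor /= /product_form mulrC.
Qed.

(* The map [id (x) g]; separating linear functionals on [E] make it independent
   of the representation of a tensor. *)
Lemma slice_map (E F : gradedSpace R f) (g : {linear F -> K^o}) m (D : R) :
  (forall x : E, (forall phi : {linear E -> K^o}, phi x = 0) -> x = 0) ->
  0 <= D -> (forall y, modulus (g y) <= D * seminorm m y) ->
  exists P : {linear algebraic_tensor E F -> E},
    (forall u s, inclusion u = tensor_sum s ->
       P u = \sum_(z <- s) g z.2 *: z.1) /\
    forall p u, seminorm p (P u) <= D * seminorm (maxn p m) u.
Proof.
move=> sep D0 gD; pose h (s : seq (E * F)) := \sum_(z <- s) g z.2 *: z.1.
have hE s t : tensor_sum s = tensor_sum t -> h s = h t.
  move=> st; apply/eqP; rewrite -subr_eq0; apply/eqP/sep => phi.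
  by rewrite linearB -!tensor_sum_product_form st subrr.
have /choice[r rP] (u : algebraic_tensor E F) :
    exists s, inclusion u = tensor_sum s.
  by have /asboolP[s us] := linear_subspaceP u; exists s.
have hr u s : inclusion u = tensor_sum s -> h (r u) = h s.
  by move=> us; apply: hE; rewrite -us rP.
have [P PE] : exists P : {linear algebraic_tensor E F -> E},
    forall u, P u = h (r u).
  apply: (@linear_function _ _ (algebraic_tensor E F)) => a u v.
  rewrite (hr _ ([seq (a *: z.1, z.2) | z <- r u] ++ r v)).
    rewrite /h big_cat big_map scaler_sumr; congr (_ + _).
    by apply: eq_bigr => z _ /=; rewrite !scalerA mulrC.
  by rewrite tensor_sumD tensor_sumZ -!rP.
exists P; split=> [u s us|p u]; first by rewrite PE; exact: hr.
apply/ler_addgt0Pr => e e0; have c0 : 0 < D + 1 by rewrite ltr_wpDl.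
(* Level [maxn p m] dominates both [p], used on the first factors, and [m], used on the second;
   [D + 1] keeps the divisor positive. *)
have [s us se] := projective_seminorm_adherent (maxn p m) u (divr_gt0 e0 c0).
rewrite PE (hr _ _ us).
have hs : seminorm p (h s) <= D * representation_cost (maxn p m) s.
  rewrite /h /representation_cost; elim: (s) => [|z t IH].
    by rewrite !big_nil seminorm0 mulr0.
  rewrite !big_cons mulrDr; apply: (le_trans (seminormD _ _ _)).
  rewrite lerD // seminormZ mulrCA [leLHS]mulrC ler_pM ?modulus_ge0 //.
  - exact: seminorm_ge0.
  - exact/seminorm_incr/leq_maxl.
  - apply: (le_trans (gD _)); rewrite ler_wpM2l //.
    exact/seminorm_incr/leq_maxr.
apply: (le_trans hs); apply: (le_trans (ler_wpM2l D0 (ltW se))).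
rewrite mulrDr lerD2l mulrCA ler_piMr ?(ltW e0) //.
by rewrite ler_pdivrMr // mul1r lerDl.
Qed.

Lemma tensor_linearl (E F : gradedSpace R f) (y : F) :
  linear ((@tensor R f E F)^~ y).
Proof.
move=> a x x'; rewrite /tensor -linearP; congr embedding.
apply: val_inj; apply/funext => b /=.
by rewrite /elementary_tensor linearPl.
Qed.

Lemma tensor_linearr (E F : gradedSpace R f) (x : E) :
  linear (@tensor R f E F x).
Proof.
move=> a y y'; rewrite /tensor -linearP; congr embedding.
apply: val_inj; apply/funext => b /=.
by rewrite /elementary_tensor linearPr.
Qed.

Lemma seminorm_tensor_le (E F : gradedSpace R f) k (x : E) (y : F) :
  seminorm k (tensor x y) <= seminorm k x * seminorm k y.
Proof.
rewrite /tensor seminorm_embedding.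
have := @projective_seminorm_le R f E F k
  (LinearSubspace (elementary_is_tensor x y)) [:: (x, y)].
rewrite /representation_cost big_seq1; apply.
by rewrite /tensor_sum big_seq1.
Qed.

Lemma embedding_tensor_sum (E F : gradedSpace R f)
    (u : algebraic_tensor E F) s :
  inclusion u = tensor_sum s ->
  embedding u = \sum_(z <- s) tensor z.1 z.2 :> projective_tensor E F.
Proof.
move=> us; rewrite /tensor -linear_sum; congr embedding.
apply: val_inj; rewrite [LHS]us /tensor_sum.
elim: (s) => [|z t IH]; first by rewrite !big_nil.
by rewrite !big_cons IH.
Qed.

End completed_tensor_product.

(** * Finite-rank approximation in a nuclear space *)

Section nuclear_factor.
Variables (R : realType) (f : scalars).
Local Notation K := (Defs.scalar R f).

Lemma dual_normP (F : gradedSpace R f) m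
    (g : {linear local_banach F m -> K^o}) : (dual_norm g < +oo)%E ->
  exists d : R, [/\ 0 <= d, dual_norm g = d%:E &
    forall x, modulus (g x) <= d * seminorm 0 x].
Proof.
have ub x : seminorm 0 x <= 1 -> ((modulus (g x))%:E <= dual_norm g)%E.
  by move=> x1; apply: ereal_sup_ubound; exists x.
have := ub 0; rewrite seminorm0 ler01 linear0 modulus0 => /(_ isT).
case: (dual_norm g) ub => [d| |] // ub; rewrite lee_fin => d0 _.
exists d; split=> //.
apply: (@homogeneous_bound R f (local_banach F m) (fun x => modulus (g x))
  (seminorm 0)).
- by move=> a x; rewrite linearZ; exact: modulusM.
- exact: seminormZ.
- exact: seminorm_ge0.
- by move=> x /ub; rewrite lee_fin.
Qed.

Lemma linear_subr_sum (U V : lmodType K) (T : {linear U -> V}) x n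
    (a : 'I_n -> K) (z : 'I_n -> U) :
  T (x - \sum_(i < n) a i *: z i) = T x - \sum_(i < n) a i *: T (z i).
Proof.
by rewrite linearB linear_sum; under eq_bigr do rewrite linearZ.
Qed.

(* The vectors of the nuclear representation lie in the completion
   [local_banach F k]; on finitely many points they may be taken in [F]. *)
Lemma nuclear_approximation (F : gradedSpace R f) k : nuclear F ->
  exists m (h : nat -> {linear F -> K^o}) (d : nat -> R) (M : R),
  [/\ forall i, 0 <= d i, forall i x, modulus (h i x) <= d i * seminorm m x &
    forall (l : seq F) (e : R), 0 < e -> exists n (y : nat -> F),
      \sum_(i < n) d i * seminorm k (y i) <= M /\
      forall x, x \in l -> seminorm k (x - \sum_(i < n) h i x *: y i) <= e].
Proof.
move=> /(_ k)[m [km [g [y [gfin gsum gy]]]]].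
have /choice[d dP] i := dual_normP (gfin i).
have d0 i : 0 <= d i by have [] := dP i.
have gd i x : modulus (g i x) <= d i * seminorm 0 x by have [_ _] := dP i.
(* The functionals on the local Banach space at level [m] are pulled back to [F]. *)
have /choice[h hE] i : exists h : {linear F -> K^o},
    forall x, h x = g i (@embedding R f (localized F m) x).
  apply: (@linear_function R f F) => a u v.
  by rewrite -linearP; congr (g i _); exact: embedding_linear.
have [M MP] : exists M : R,
    forall n, \sum_(i < n) d i * seminorm 0 (y i) <= M.
  have t0 i : (0 <= dual_norm (g i) * (seminorm 0 (y i))%:E)%E.
    by have [_ -> _] := dP i; rewrite -EFinM lee_fin mulr_ge0 ?seminorm_ge0.
  have le n := @nneseries_lim_ge R
    (fun i => dual_norm (g i) * (seminorm 0 (y i))%:E)%E xpredT 0 n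
    (fun i _ _ => t0 i).
  have s0 := nneseries_ge0 (P := xpredT) (N := 0) (fun i _ _ => t0 i).
  case: (\sum_(0 <= i <oo) _)%E le s0 gsum => [M| |] // le _ _.
  exists M => n; have := le n.
  rewrite big_mkord (eq_bigr (fun i : 'I_n => (d i * seminorm 0 (y i))%:E)).
    by rewrite sumEFin lee_fin.
  by move=> i _; have [_ -> _] := dP i.
exists m, h, d, (M + 1); split=> // [i x|l e e0].
  rewrite hE; apply: (le_trans (gd _ _)).
  by rewrite (@seminorm_embedding R f (localized F m)).
have e20 : 0 < e / 2 by rewrite divr_gt0.
(* One truncation serves all points of [l], which is finite. *)
have [n nP] : exists n, forall x, x \in l ->
    seminorm 0 ((@embedding R f (localized F k) x : local_banach F k) -
      \sum_(i < n) h i x *: y i) < e / 2.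
  have [N NP] : exists N, forall n, (N <= n)%N -> forall x, x \in l ->
      seminorm 0 ((@embedding R f (localized F k) x : local_banach F k) -
        \sum_(i < n) h i x *: y i) < e / 2.
    elim: l => [|z l [N NP]]; first by exists 0%N.
    have := gy (@embedding R f (localized F m) z).
    rewrite linking_map_embedding => /graded_cvgP/(_ 0%N _ e20)[N' N'P].
    exists (maxn N N') => n; rewrite geq_max => /andP[Nn N'n] x.
    rewrite in_cons => /orP[/eqP ->|xl]; last exact: NP.
    by under eq_bigr do rewrite hE; exact: N'P.
  by exists N; exact: NP.
(* With this normalization, moving each [y i] by less than [w] into [F] costs at most 1 in the
   weighted sum, hence the bound [M + 1], and at most [e / 2] at each point of [l]. *)
pose S := 1 + \sum_(i < n) (d i + \sum_(x <- l) modulus (h i x)).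
have s0 i : 0 <= d i + \sum_(x <- l) modulus (h i x).
  by rewrite addr_ge0 // sumr_ge0 // => x _; exact: modulus_ge0.
have S0 : 0 < S by rewrite ltr_wpDr // sumr_ge0.
pose w := Num.min 1 (e / 2) / S.
have w0 : 0 < w by rewrite divr_gt0 // lt_min ltr01.
have wS (a : nat -> R) :
    (forall i, a i <= d i + \sum_(x <- l) modulus (h i x)) ->
    \sum_(i < n) a i * w <= Num.min 1 (e / 2).
  move=> ab; rewrite -mulr_suml /w mulrA ler_pdivrMr // mulrC.
  rewrite ler_wpM2l //; first by rewrite le_min ler01 ltW.
  by apply: ler_wpDl => //; apply: ler_sum => i _; exact: ab.
have /choice[z zP] i : exists z : F,
    seminorm 0 (y i - @embedding R f (localized F k) z) < w.
  exact: (@embedding_dense R f (localized F k)).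
exists n, z; split=> [|x xl].
  apply: (@le_trans _ _ (\sum_(i < n) (d i * seminorm 0 (y i) + d i * w))).
    apply: ler_sum => i _; rewrite -mulrDr ler_wpM2l //.
    rewrite -[seminorm k (z i)]/(seminorm 0 (z i : localized F k)).
    rewrite -(@seminorm_embedding R f (localized F k)) -lerBlDl.
    apply: le_trans (ltW (zP i)); apply: (le_trans (ler_norm _)).
    by rewrite seminormB; exact: seminorm_dist.
  rewrite big_split /= lerD ?MP //; apply: (le_trans (wS d _)) => [i|].
    by rewrite lerDl sumr_ge0 // => ? _; exact: modulus_ge0.
  by rewrite ge_min lexx.
rewrite -[seminorm k _]/(seminorm 0 (_ : localized F k)).
rewrite -(@seminorm_embedding R f (localized F k)).
have -> : @embedding R f (localized F k) (x - \sum_(i < n) h i x *: z i) =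
    @embedding R f (localized F k) x -
    \sum_(i < n) h i x *: @embedding R f (localized F k) (z i).
  exact: (@linear_subr_sum (localized F k) (completion_graded (localized F k))
    (@embedding R f (localized F k))).
apply: (le_trans (seminorm_tri 0 _ (\sum_(i < n) h i x *: y i) _)).
rewrite [e]splitr lerD //; first exact/ltW/nP.
rewrite -sumrB; under eq_bigr do rewrite -scalerBr.
apply: (le_trans (@seminorm_sum _ _ (local_banach F k) 0 n (fun i => h i x *:
  (y i - @embedding R f (localized F k) (z i))))).
apply: (@le_trans _ _ (\sum_(i < n) modulus (h i x) * w)).
  apply: ler_sum => i _; rewrite seminormZ ler_wpM2l ?modulus_ge0 //.
  exact/ltW/zP.
apply: (le_trans (wS (fun i => modulus (h i x)) _)) => [i|].
  apply: ler_wpDl => //; rewrite (big_rem _ xl) /= lerDl.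
  by rewrite sumr_ge0 // => ? _; exact: modulus_ge0.
by rewrite ge_min lexx orbT.
Qed.

End nuclear_factor.

(** * Bounding an operator on the tensor product through slices *)

Section tensor_operators.
Variables (R : realType) (f : scalars).
Local Notation K := (Defs.scalar R f).

Lemma le_linear_perturbation (a b c : R) :
  0 <= c -> (forall e, 0 < e -> a <= b + c * e) -> a <= b.
Proof.
move=> c0 h; apply/ler_addgt0Pr => e e0.
have c1 : 0 < c + 1 by rewrite ltr_wpDl.
apply: (le_trans (h _ (divr_gt0 e0 c1))); rewrite lerD2l mulrCA.
by rewrite ler_piMr ?(ltW e0) // ler_pdivrMr // mul1r lerDl.
Qed.

Lemma tensor_mapl (E F G : gradedSpace R f)
    (Q : {linear projective_tensor E F -> G}) y :
  exists L : {linear E -> G}, forall x, L x = Q (tensor x y).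
Proof.
apply: (@linear_function R f E) => a x x'.
by rewrite tensor_linearl linearP.
Qed.

Lemma tensor_mapr (E F G : gradedSpace R f)
    (Q : {linear projective_tensor E F -> G}) x :
  exists L : {linear F -> G}, forall y, L y = Q (tensor x y).
Proof.
apply: (@linear_function R f F) => a y y'.
by rewrite tensor_linearr linearP.
Qed.

Variables (E F G : gradedSpace R f) (Q : {linear projective_tensor E F -> G}).
Variables (r s k m : nat) (C : R).
Hypothesis C0 : 0 <= C.
Hypothesis QC : forall x y,
  seminorm r (Q (tensor x y)) <= C * seminorm s x * seminorm k y.
Variables (h : nat -> {linear F -> K^o}) (d : nat -> R) (M : R).
Hypothesis d0 : forall i, 0 <= d i.
Hypothesis approx : forall (l : seq F) (e : R), 0 < e ->
  exists n (y : nat -> F), \sum_(i < n) d i * seminorm k (y i) <= M /\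
    forall x, x \in l -> seminorm k (x - \sum_(i < n) h i x *: y i) <= e.
Variable P : nat -> {linear algebraic_tensor E F -> E}.
Hypothesis PE : forall i u t, inclusion u = tensor_sum t ->
  P i u = \sum_(z <- t) h i z.2 *: z.1.

(** Replacing each second factor [z.2] by [\sum_i h i z.2 *: y i] turns [u] into the sum of the
    [P i u] tensor [y i], whose image is at most [C * c * M]. The remainder is at most [e] times a
    constant of the chosen representation; [n] and [y] vary with [e], but [M] does not. *)
Lemma algebraic_tensor_bound (u : algebraic_tensor E F) (c : R) : 0 <= c ->
  (forall i, seminorm s (P i u) <= c * d i) ->
  seminorm r (Q (@embedding R f (algebraic_tensor E F) u)) <= C * c * M.
Proof.
move=> c0 uc; have /asboolP[t ut] := linear_subspaceP u.
have Z0 : 0 <= \sum_(z <- t) seminorm s z.1.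
  by apply: sumr_ge0 => z _; exact: seminorm_ge0.
apply: (@le_linear_perturbation _ _ (C * \sum_(z <- t) seminorm s z.1)).
  exact: mulr_ge0.
move=> e e0; have [n [y [yM ye]]] := approx [seq z.2 | z <- t] e0.
have -> : Q (@embedding R f (algebraic_tensor E F) u) =
    (\sum_(i < n) Q (tensor (P i u) (y i))) +
    \sum_(z <- t) Q (tensor z.1 (z.2 - \sum_(i < n) h i z.2 *: y i)).
  have -> : \sum_(i < n) Q (tensor (P i u) (y i)) =
      \sum_(z <- t) \sum_(i < n) h i z.2 *: Q (tensor z.1 (y i)).
    rewrite exchange_big /=; apply: eq_bigr => i _; rewrite (PE i ut).
    have [L LE] := tensor_mapl Q (y i).
    by rewrite -LE linear_sum; apply: eq_bigr => z _; rewrite linearZ -LE.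
  rewrite -big_split /= (embedding_tensor_sum ut) linear_sum.
  apply: eq_bigr => z _; have [L LE] := tensor_mapr Q z.1.
  rewrite -!LE linear_subr_sum; under eq_bigr do rewrite -LE.
  by rewrite addrC subrK.
apply: (le_trans (seminormD _ _ _)); apply: lerD.
  apply: (le_trans (@seminorm_sum R f G r n
    (fun i => Q (tensor (P i u) (y i))))).
  apply: le_trans (ler_wpM2l (mulr_ge0 C0 c0) yM); rewrite mulr_sumr.
  apply: ler_sum => i _; apply: (le_trans (QC _ _)).
  rewrite mulrA ler_wpM2r ?seminorm_ge0 // -mulrA ler_wpM2l //.
elim: (t) ye => [_|z t' IH ye]; first by rewrite !big_nil seminorm0 mulr0 mul0r.
rewrite !big_cons mulrDr mulrDl; apply: (le_trans (seminormD _ _ _)).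
apply: lerD; last by apply: IH => x xt; apply: ye; rewrite inE xt orbT.
apply: (le_trans (QC _ _)); rewrite ler_wpM2l ?mulr_ge0 ?seminorm_ge0 //.
by apply: ye; rewrite inE eqxx.
Qed.

Hypothesis Qc : continuous Q.
Variable P' : nat -> {linear projective_tensor E F -> E}.
Hypothesis P'E : forall i u,
  P' i (@embedding R f (algebraic_tensor E F) u) = P i u.
Hypothesis P'd : forall i u, seminorm s (P' i u) <= d i * seminorm (maxn s m) u.

(** An algebraic tensor [u] within [e] of [q] has slices bounded with [c + e] in place of [c], and
    continuity of [Q] controls the difference of the images. *)
Lemma projective_tensor_bound (q : projective_tensor E F) (c : R) : 0 <= c ->
  (forall i, seminorm s (P' i q) <= c * d i) ->
  seminorm r (Q q) <= C * c * M.
Proof.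
move=> c0 qc; have [N [D [D0 QD]]] := continuous_seminorm Qc r.
(* Any instance of [approx], here for the empty list, bounds a nonnegative sum by [M]. *)
have M0 : 0 <= M.
  have [n [y [yM _]]] := approx [::] ltr01; apply: le_trans yM.
  by apply: sumr_ge0 => i _; rewrite mulr_ge0 ?seminorm_ge0.
apply: (@le_linear_perturbation _ _ (C * M + D)).
  by rewrite addr_ge0 ?mulr_ge0.
(* [N] is the level for the continuity of [Q], [maxn s m] that for the slices. *)
move=> e e0; pose j := maxn N (maxn s m).
have [u ue] := @embedding_dense R f (algebraic_tensor E F) q j e e0.
rewrite -[q](subrK (@embedding R f (algebraic_tensor E F) u)) linearD addrC.
have -> : C * c * M + (C * M + D) * e = C * (c + e) * M + D * e by ring.
apply: (le_trans (seminormD _ _ _)); apply: lerD.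
  apply: algebraic_tensor_bound => [|i]; first by rewrite addr_ge0 // ltW.
  rewrite -P'E -[X in P' i X](subKr q) linearB.
  apply: (le_trans (seminormD _ _ _)); rewrite seminormN mulrDl lerD //.
  apply: (le_trans (P'd _ _)); rewrite mulrC ler_wpM2r //.
  apply: (le_trans (seminorm_incr _ (leq_maxr N (maxn s m)))).
  exact: ltW.
apply: (le_trans (QD _)); rewrite ler_wpM2l //.
apply: (le_trans (seminorm_incr _ (leq_maxl N (maxn s m)))).
exact: ltW.
Qed.

End tensor_operators.

(** * Separation of Köthe spaces by coordinates, and the factorization property *)

Lemma kothe_separated (R : realType) (f : scalars) (l : lambdaSpace R f)
    (A : kotheMatrix R) (x : kothe l A) :
  (forall phi : {linear kothe l A -> (Defs.scalar R f)^o}, phi x = 0) -> x = 0.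
Proof.
move=> x0; apply: val_inj; apply/funext => n.
have [phi phiE] : exists phi : {linear kothe l A -> (Defs.scalar R f)^o},
    forall z, phi z = inclusion z n.
  exact: (@linear_function R f (kothe l A)).
by rewrite -[LHS]phiE x0.
Qed.

Theorem theorem3p3 (R : realType) (f : scalars) (E : frechetSpace R f)
    (l1 l2 l3 : lambdaSpace R f) (A B C : kotheMatrix R) :
  nuclear (kothe l1 A) -> nuclear (kothe l2 B) ->
  all_bounded E (kothe l1 A) ->
  all_bounded (kothe l2 B) (kothe l3 C) ->
  bounded_factorization E
    (projective_tensor (kothe l1 A) (kothe l2 B)) (kothe l3 C).
Proof.
move=> _ nucB EA BC T Tc [S [Q [Sc Qc TQS]]].
have /choice[V VE] := tensor_mapr Q.
(* The family is indexed by the first tensor factor [z], with its seminorms as weights; the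
   resulting [k] precedes [r] and [z]. *)
have [k kP] : exists k, forall r, exists s c, forall z y,
    seminorm r (V z y) <= c * seminorm s z * seminorm k y.
  apply: (all_bounded_uniform (w := fun z s => seminorm s z)) => //.
  - by move=> z s; exact: seminorm_ge0.
  - by move=> z s; exact: seminorm_incr.
  move=> p; have [N [c [c0 Qp]]] := continuous_seminorm Qc p.
  exists N, c; split=> // z y; rewrite VE; apply: (le_trans (Qp _)).
  by rewrite -mulrA ler_wpM2l // seminorm_tensor_le.
have [m [h [d [M [d0 hd approx]]]]] := nuclear_approximation k nucB.
have /choice[P PP] i := slice_map (@kothe_separated R f l1 A) (d0 i) (hd i).
have /choice[P' P'P] i := completion_extension (N := fun p => maxn p m)
  (fun p => d0 i) (PP i).2.
have /choice[W WE] i : exists W : {linear E -> kothe l1 A},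
    forall x, W x = P' i (S x).
  by apply: (@linear_function R f E) => a x y; rewrite !linearP.
(* The slices of [S] are weighted by [d i], constant in the level, so [n] is fixed before the level
   [s], which depends on [r]. *)
have [n nP] : exists n, forall s, exists (q : nat) c, forall i x,
    seminorm s (W i x) <= c * d i * seminorm n x.
  apply: (all_bounded_uniform (T := W) (w := fun i _ => d i)) => // p.
  have [N [c [c0 Sp]]] := continuous_seminorm Sc (maxn p m).
  exists N, c; split=> // i x; rewrite WE.
  apply: (le_trans ((P'P i).2 p _)).
  by rewrite mulrAC [leRHS]mulrC ler_wpM2l.
apply/bounded_operatorP; exists n => r.
have [s [c kc]] := kP r; have [_ [b nb]] := nP s.
(* Absolute values, since uniform boundedness yields constants without a sign. *)
exists (`|c| * `|b| * M) => x; rewrite TQS /=.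
rewrite mulrAC -[_ * _ * seminorm n x]mulrA.
have Qb z y :
    seminorm r (Q (tensor z y)) <= `|c| * seminorm s z * seminorm k y.
  rewrite -VE; apply: (le_trans (kc _ _)).
  by rewrite !ler_wpM2r ?seminorm_ge0 ?ler_norm.
(* The slice bound [c] of the lemma is here [|b|] times the [n]-th seminorm of [x]. *)
apply: (projective_tensor_bound (normr_ge0 c) Qb d0 approx
  (fun i => (PP i).1) Qc (fun i => (P'P i).1) (fun i => (P'P i).2 s)).
  by rewrite mulr_ge0 ?seminorm_ge0.
move=> i; rewrite -WE; apply: (le_trans (nb i x)); rewrite mulrAC ler_wpM2r //.
by rewrite ler_wpM2r ?seminorm_ge0 ?ler_norm.
Qed.
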